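(* Let $u\subseteq\{1,\dots,d\}$ with $u\neq\varnothing$, $u\neq\{1,\dots,d\}$, let $g$ be an auxiliary probability density on $\mathbb{X}$ such that $g(\mathbf{x})>0$ whenever $\psi_t(\mathbf{x})f_{\mathbf{X}}(\mathbf{x})>0$, and let $N\ge 1$, $N_u\ge 1$, $N_I\ge 2$ be integers. Then the estimator $\widehat{\text{T-EV}}_{u,\text{MC}}^{\text{IS}}$ defined in the context is an unbiased estimator of $\text{T-EV}_u=\mathbb{E}_{f_{\mathbf{X}}}\left[\mathbb{V}_{f_{\mathbf{X}}}\left(\psi_t(\mathbf{X})\,|\,\mathbf{X}_{-u}\right)\right]$, i.e. $$\mathbb{E}_g\left[\widehat{\text{T-EV}}_{u,\text{MC}}^{\text{IS}}\right]=\text{T-EV}_u,$$ and it requires $N_uN_I$ evaluations of the function $\phi$ in addition to those used in $\widehat{p}_{t,N}^{\text{IS}}$ to estimate $p_t$.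
   Context: $\mathbb{X}=\mathbb{X}_1\times\dots\times\mathbb{X}_d\subseteq\mathbb{R}^d$; $\mathbf{X}=(X_1,\dots,X_d)$ is a random vector in $\mathbb{X}$ with joint density $f_{\mathbf{X}}$ (components possibly dependent); $\phi:\mathbb{X}\to\mathbb{R}$ is a measurable function, $t\in\mathbb{R}$, $\psi_t(\mathbf{x})=\mathbf{1}(\phi(\mathbf{x})>t)$ and $p_t=\mathbb{P}(\phi(\mathbf{X})>t)$. For $u\subseteq\{1,\dots,d\}$, $-u=\{1,\dots,d\}\setminus u$, $\mathbf{X}_u=(X_i)_{i\in u}$, and $(\mathbf{x}_u,\mathbf{x}_{-u})$ denotes the vector of $\mathbb{X}$ with these sub-vectors. $f_{\mathbf{X}_{-u}}$ and $g_{\mathbf{X}_{-u}}$ are the marginal densities on the coordinates $-u$ of $f_{\mathbf{X}}$ and $g$; $g_{\mathbf{X}_u|\mathbf{X}_{-u}=\mathbf{x}_{-u}}$ is the conditional density under $g$. $\mathbb{E}_h,\mathbb{V}_h$ denote expectation and variance when the underlying vector has density $h$ (for estimators under $g$: when the samples are drawn from $g$ as described below). Define $w_t^g(\mathbf{x})=\psi_t(\mathbf{x})f_{\mathbf{X}}(\mathbf{x})/g(\mathbf{x})$. The convention $0/0=0$ is used; in particular any term involving a factor $w_t^g(\mathbf{x}_u,\mathbf{x}_{-u})$ with $f_{\mathbf{X}_{-u}}(\mathbf{x}_{-u})=0$ is set to $0$, even when it is divided by $f_{\mathbf{X}_{-u}}(\mathbf{x}_{-u})$. Samples: $(\mathbf{X}_{-u}^{(n)})_{1\le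 n\le N_u}$ is i.i.d. with density $g_{\mathbf{X}_{-u}}$; for each $n$, conditionally on $\mathbf{X}_{-u}^{(n)}$, $(\mathbf{X}_u^{(n,k)})_{1\le k\le N_I}$ is i.i.d. with density $g_{\mathbf{X}_u|\mathbf{X}_{-u}=\mathbf{X}_{-u}^{(n)}}$. Also $\widehat{p}_{t,N}^{\text{IS}}=\frac1N\sum_{n=1}^N w_t^g(\mathbf{X}^{(n)})$ with $(\mathbf{X}^{(n)})_{1\le n\le N}$ i.i.d. with density $g$. Estimator: $$\overline{\psi_t^{\text{IS}}(\mathbf{X}_{-u}^{(n)})}=\frac1{N_I}\sum_{k=1}^{N_I}w_t^g\left(\mathbf{X}_u^{(n,k)},\mathbf{X}_{-u}^{(n)}\right),$$ $$\widehat{E}_{\text{bias},u}^{\text{IS}}=\frac1{N_u}\sum_{n=1}^{N_u}\frac1{N_I-1}\left[\frac1{N_I}\sum_{k=1}^{N_I}w_t^g\left(\mathbf{X}_u^{(n,k)},\mathbf{X}_{-u}^{(n)}\right)^2-\left(\overline{\psi_t^{\text{IS}}(\mathbf{X}_{-u}^{(n)})}\right)^2\right]\frac{g_{\mathbf{X}_{-u}}(\mathbf{X}_{-u}^{(n)})}{f_{\mathbf{X}_{-u}}(\mathbf{X}_{-u}^{(n)})},$$ $$\widehat{\text{T-EV}}_{u,\text{MC}}^{\text{IS}}=\widehat{p}_{t,N}^{\text{IS}}-\left(\frac1{N_u}\sum_{n=1}^{N_u}\left(\overline{\psi_t^{\text{IS}}(\mathbf{X}_{-u}^{(n)})}\right)^2\frac{g_{\mathbf{X}_{-u}}(\mathbf{X}_{-u}^{(n)})}{f_{\mathbf{X}_{-u}}(\mathbf{X}_{-u}^{(n)})}-\widehat{E}_{\text{bias},u}^{\text{IS}}\right).$$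 *)

(* Defs.v *)
From HB Require Import structures.
From mathcomp Require Import all_boot all_order all_algebra.
From mathcomp Require Import all_classical all_reals all_analysis.

Set Implicit Arguments.
Unset Strict Implicit.
Unset Printing Implicit Defensive.

Import Order.TTheory GRing.Theory Num.Theory.
Import numFieldNormedType.Exports.

Local Open Scope classical_set_scope.
Local Open Scope ring_scope.

Section lebesgue_tuple_step.
Context {R : realType} (n : nat).
Variable m : {sigma_finite_measure set (n.-tuple R) -> \bar R}.

Definition cons_pair (x : measurableTypeR R * n.-tuple R) : n.+1.-tuple R :=
  [the n.+1.-tuple R of x.1 :: x.2].

Let measurable_cons_pair : measurable_fun setT cons_pair.
Proof. exact: measurable_cons. Qed.

Definition lebesgue_tuple_step : set (n.+1.-tuple R) -> \bar R :=
  pushforward (lebesgue_measure \x m)%E cons_pair.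

Let mpre A : measurable A -> measurable (cons_pair @^-1` A).
Proof. by move=> mA; rewrite -[X in measurable X]setTI; exact: measurable_cons_pair. Qed.

Let step0 : lebesgue_tuple_step set0 = 0%E.
Proof. by rewrite /lebesgue_tuple_step /pushforward preimage_set0 measure0. Qed.

Let step_ge0 A : (0 <= lebesgue_tuple_step A)%E.
Proof. exact: measure_ge0. Qed.

Let step_sigma_additive : semi_sigma_additive lebesgue_tuple_step.
Proof.
move=> F mF tF mUF; rewrite /lebesgue_tuple_step /pushforward preimage_bigcup.
apply: measure_semi_sigma_additive.
- by move=> k; exact: mpre.
- apply/trivIsetP => /= i j _ _ ij; rewrite -preimage_setI.
  by move/trivIsetP : tF => /(_ _ _ _ _ ij) ->//; rewrite preimage_set0.
- by rewrite -preimage_bigcup; exact: mpre.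
Qed.

HB.instance Definition _ := isMeasure.Build _ _ _ lebesgue_tuple_step
  step0 step_ge0 step_sigma_additive.

Let step_sigma_finite : sigma_finite setT lebesgue_tuple_step.
Proof.
have [F [FT ndF mF]] := (sigma_finiteP setT (@lebesgue_measure R)).1
  (sigma_finiteT (@lebesgue_measure R)).
have [G [GT ndG mG]] := (sigma_finiteP setT m).1 (sigma_finiteT m).
pose hd (t : n.+1.-tuple R) : measurableTypeR R := thead t.
pose tl (t : n.+1.-tuple R) : n.-tuple R := [tuple of behead t].
exists (fun i => (hd @^-1` F i) `&` (tl @^-1` G i)).
  apply/seteqP; split=> // t _.
  have [i _ Fi] : (\bigcup_i F i) (hd t) by rewrite -FT.
  have [j _ Gj] : (\bigcup_i G i) (tl t) by rewrite -GT.
  exists (maxn i j) => //; split.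
    by have /subsetPset := ndF _ _ (leq_maxl i j); apply.
  by have /subsetPset := ndG _ _ (leq_maxr i j); apply.
move=> i; have [[mFi Fi] [mGi Gi]] := (mF i, mG i); split.
  apply: measurableI; rewrite -[X in measurable X]setTI.
    by apply: (measurable_tnth ord0).
  exact: measurable_behead.
rewrite /lebesgue_tuple_step /pushforward.
rewrite (_ : _ @^-1` _ = F i `*` G i); last first.
  have tlE x t : tl (cons_pair (x, t)) = t by exact: val_inj.
  by apply/seteqP; split=> -[x t] []/=; rewrite tlE.
by rewrite product_measure1E// lte_mul_pinfty// ge0_fin_numE.
Qed.

HB.instance Definition _ := Measure_isSigmaFinite.Build _ _ _
  lebesgue_tuple_step step_sigma_finite.

End lebesgue_tuple_step.

Fixpoint lebesgue_tuple {R : realType} (n : nat) :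
    {sigma_finite_measure set (n.-tuple R) -> \bar R} :=
  if n is n'.+1 then lebesgue_tuple_step (lebesgue_tuple n')
  else \d_([tuple] : 0.-tuple R).

(* This property characterizes Lebesgue measure on R^n. *)
Lemma lebesgue_tuple_box {R : realType} (n : nat)
    (A : 'I_n -> set (measurableTypeR R)) :
  (forall i, measurable (A i)) ->
  lebesgue_tuple n [set x : n.-tuple R | forall i, A i (tnth x i)] =
  (\prod_(i < n) lebesgue_measure (A i))%E.
Proof.
elim: n A => [|n IH] A mA.
  rewrite big_ord0 /= diracE mem_set//= => -[].
  by [].
rewrite big_ord_recl -IH//= /lebesgue_tuple_step /pushforward.
rewrite -product_measure1E//; last first.
  rewrite (_ : [set _ | _] = \bigcap_(i in [set: 'I_n])
      ((@tnth n R)^~ i @^-1` A (lift ord0 i))).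
    apply: fin_bigcap_measurable => // i _; rewrite -[X in measurable X]setTI.
    exact: (@measurable_tnth _ R n i measurableT _ (mA _)).
  by apply/seteqP; split=> [x h i _|x h i]; exact: h.
congr (_ _); apply/seteqP; split => -[x t] /=.
  move=> h; split; first by have := h ord0.
  by move=> i; have := h (lift ord0 i); rewrite tnthS.
by case=> xA tA i; case: (unliftP ord0 i) => [j|] ->; rewrite ?tnthS.
Qed.

Section subvectors.
Context {R : realType} {d : nat} (u : {set 'I_d}).

(* The components x_i, i in v, in increasing order of i. *)
Definition subvec (v : {set 'I_d}) (x : d.-tuple R) : #|v|.-tuple R :=
  [tuple tnth x (enum_val i) | i < #|v|].

(* The vector (x_u, x_{-u}); glueK and subvec_glue show that it inverts the
   splitting x |-> (x_u, x_{-u}). *)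
Definition glue (xu : #|u|.-tuple R) (xmu : #|~: u|.-tuple R) : d.-tuple R :=
  [tuple if i \in u then nth 0 xu (index i (enum u))
         else nth 0 xmu (index i (enum (~: u))) | i < d].

Lemma glueK (x : d.-tuple R) : glue (subvec u x) (subvec (~: u) x) = x.
Proof.
have aux (v : {set 'I_d}) i : i \in v ->
    nth 0 (subvec v x) (index i (enum v)) = tnth x i.
  move=> iv; have hi : (index i (enum v) < #|v|)%N.
    by rewrite cardE index_mem mem_enum.
  rewrite -[index _ _]/(val (Ordinal hi)) -tnth_nth tnth_mktuple.
  by rewrite (enum_val_nth i) nth_index// mem_enum.
apply: eq_from_tnth => i; rewrite tnth_mktuple; case: ifPn => iu; first exact: aux.
by rewrite aux// finset.in_setC.
Qed.

Lemma subvec_glue (xu : #|u|.-tuple R) (xmu : #|~: u|.-tuple R) :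
  (subvec u (glue xu xmu) = xu) * (subvec (~: u) (glue xu xmu) = xmu).
Proof.
split; apply: eq_from_tnth => i; rewrite !tnth_mktuple.
  rewrite enum_valP (enum_val_nth (enum_val i)) index_uniq ?enum_uniq -?cardE//.
  by rewrite -tnth_nth.
have := enum_valP i; rewrite finset.in_setC => /negbTE ->.
rewrite (enum_val_nth (enum_val i)) index_uniq ?enum_uniq -?cardE//.
by rewrite -tnth_nth.
Qed.

End subvectors.

Section densities.
Context {R : realType}.

Definition prod_set {d} (D : 'I_d -> set R) : set (d.-tuple R) :=
  [set x | forall i, D i (tnth x i)].

(* A density on D is extended by 0 outside D, so that integrals over D are
   integrals over the whole space. *)
Definition is_density {n} (D : set (n.-tuple R)) (h : n.-tuple R -> R) : Prop :=
  [/\ measurable_fun setT h, forall x, 0 <= h x, forall x, ~ D x -> h x = 0 &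
      (\int[lebesgue_tuple n]_x (h x)%:E = 1)%E].

(* Marginal density of h on the coordinates -u. As a real-valued integral it
   takes the value 0 (not +oo) where the integral diverges; if h is a density,
   this is a Lebesgue-null set of y. *)
Definition marginalC {d} (u : {set 'I_d}) (h : d.-tuple R -> R)
    (y : #|~: u|.-tuple R) : R :=
  \int[lebesgue_tuple #|u|]_x h (glue x y).

(* Density of the coordinates u given that those in -u are y; here, and in all
   quotients below, division by 0 yields 0. *)
Definition cond_density {d} (u : {set 'I_d}) (h : d.-tuple R -> R)
    (y : #|~: u|.-tuple R) (x : #|u|.-tuple R) : R :=
  h (glue x y) / marginalC h y.

End densities.
Arguments marginalC {R d} u h y.
Arguments cond_density {R d} u h y x.

Section random_vectors.
Context {R : realType} {d} {T : measurableType d} (P : probability T R).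

Definition has_density {n} (X : T -> n.-tuple R) (h : n.-tuple R -> R) : Prop :=
  forall A, measurable A ->
    P (X @^-1` A) = (\int[lebesgue_tuple n]_(x in A) (h x)%:E)%E.

(* Subfamilies are covered by taking some of the A i to be the full space. *)
Definition mutually_independent {d'} {T' : measurableType d'} {I : finType}
    (X : I -> T -> T') : Prop :=
  forall A : I -> set T', (forall i, measurable (A i)) ->
    P [set w | forall i, A i (X i w)] = (\prod_i P (X i @^-1` A i))%E.

Definition iid_density {n N} (X : 'I_N -> T -> n.-tuple R)
    (h : n.-tuple R -> R) : Prop :=
  (forall i, has_density (X i) h) /\ mutually_independent X.

(* Conditionally on Y, the Z k are independent, each with density q Y: the
   product of the laws q (Y w) is the regular conditional law of (Z k)_k. *)
Definition cond_iid_density {d'} {T' : measurableType d'} {n N} (Y : T -> T')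
    (Z : 'I_N -> T -> n.-tuple R) (q : T' -> n.-tuple R -> R) : Prop :=
  forall (B : set T') (A : 'I_N -> set (n.-tuple R)),
    measurable B -> (forall k, measurable (A k)) ->
    P (Y @^-1` B `&` [set w | forall k, A k (Z k w)]) =
    (\int[P]_(w in Y @^-1` B)
       \prod_(k < N) \int[lebesgue_tuple n]_(x in A k) (q (Y w) x)%:E)%E.

(* h \o Z is a version of the conditional expectation of Y given Z; by the
   Doob-Dynkin lemma every version has this form. *)
Definition is_cond_exp {d'} {T' : measurableType d'} (Z : T -> T')
    (Y : T -> R) (h : T' -> R) : Prop :=
  [/\ measurable_fun setT h, P.-integrable setT (EFin \o (h \o Z)) &
      forall B, measurable B ->
        (\int[P]_(w in Z @^-1` B) (h (Z w))%:E =
         \int[P]_(w in Z @^-1` B) (Y w)%:E)%E].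

(* Some version of the conditional expectation (any two are almost surely
   equal); the default value 0 is used only if there is none. *)
Definition cond_exp {d'} {T' : measurableType d'} (Z : T -> T')
    (Y : T -> R) : T -> R :=
  xget (cst 0) [set h | is_cond_exp Z Y h] \o Z.

Definition cond_var {d'} {T' : measurableType d'} (Z : T -> T')
    (Y : T -> R) : T -> R :=
  cond_exp Z (fun w => (Y w - cond_exp Z Y w) ^+ 2).

Definition unbiased (E : T -> R) (theta : \bar R) : Prop :=
  P.-integrable setT (EFin \o E) /\ ('E_P[E] = theta)%E.

End random_vectors.

Section estimators.
Context {R : realType} {d : nat}.
Implicit Types (phi f g : d.-tuple R -> R) (t : R) (u : {set 'I_d}).

Definition psi phi t (x : d.-tuple R) : R := (t < phi x)%R%:R.

Definition TEV {dT} {T : measurableType dT} (P : probability T R)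
    (X : T -> d.-tuple R) phi t u : \bar R :=
  'E_P[cond_var P (subvec (~: u) \o X) (psi phi t \o X)]%E.

Definition weight phi t f g (x : d.-tuple R) : R := psi phi t x * f x / g x.

Definition mean {n} (a : 'I_n -> R) : R := n%:R^-1 * \sum_i a i.

Definition p_IS phi t f g {N} (x : 'I_N -> d.-tuple R) : R :=
  mean (fun n => weight phi t f g (x n)).

(* In the next two definitions, W n k stands for the weight of the sample
   (X_u^(n,k), X_{-u}^(n)) and rho n for the ratio g_{-u} / f_{-u} of marginal
   densities at X_{-u}^(n). *)
Definition bias_of_weights {Nu NI} (W : 'I_Nu -> 'I_NI -> R)
    (rho : 'I_Nu -> R) : R :=
  mean (fun n => (NI%:R - 1)^-1 *
    (mean (fun k => W n k ^+ 2) - mean (W n) ^+ 2) * rho n).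

Definition TEV_of_weights {Nu NI} (p : R) (W : 'I_Nu -> 'I_NI -> R)
    (rho : 'I_Nu -> R) : R :=
  p - (mean (fun n => mean (W n) ^+ 2 * rho n) - bias_of_weights W rho).

Definition marginal_ratio f g u (y : #|~: u|.-tuple R) : R :=
  marginalC u g y / marginalC u f y.

Definition TEV_IS phi t f g u {N Nu NI} (x : 'I_N -> d.-tuple R)
    (y : 'I_Nu -> #|~: u|.-tuple R) (z : 'I_Nu -> 'I_NI -> #|u|.-tuple R) : R :=
  TEV_of_weights (p_IS phi t f g x)
    (fun n k => weight phi t f g (glue (z n k) (y n)))
    (fun n => marginal_ratio f g (y n)).

End estimators.
Arguments TEV_IS {R d} phi t f g u {N Nu NI} x y z.
Arguments marginal_ratio {R d} f g u y.

(* Programs computing a B with access to a function phi : Q -> A only through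
   evaluations: Query q k evaluates phi at q and continues with k (phi q). *)
Inductive oracle_prog (Q A B : Type) : Type :=
| Done of B
| Query of Q & (A -> oracle_prog Q A B).
Arguments Done {Q A B}.
Arguments Query {Q A B}.

Section oracle_programs.
Context {Q A : Type}.

Fixpoint run {B} (phi : Q -> A) (p : oracle_prog Q A B) : B :=
  match p with Done b => b | Query q k => run phi (k (phi q)) end.

Fixpoint nb_queries {B} (phi : Q -> A) (p : oracle_prog Q A B) : nat :=
  match p with Done _ => 0%N | Query q k => (nb_queries phi (k (phi q))).+1 end.

Fixpoint bind {B C} (p : oracle_prog Q A B) (r : B -> oracle_prog Q A C) :
    oracle_prog Q A C :=
  match p with Done b => r b | Query q k => Query q (fun a => bind (k a) r) end.

Fixpoint traverse {B} (n : nat) :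
    ('I_n -> oracle_prog Q A B) -> oracle_prog Q A (n.-tuple B) :=
  if n is n'.+1 then
    fun p => bind (p ord0) (fun b =>
      bind (traverse (fun i => p (lift ord0 i))) (fun s =>
        Done [the n'.+1.-tuple B of b :: s]))
  else fun=> Done [tuple].

End oracle_programs.

(* Programs computing the estimators from the samples: phi is evaluated once at
   each sample point, and each weight so obtained is reused wherever it occurs
   in the estimator. *)
Section estimation_programs.
Context {R : realType} {d : nat}.
Notation prog := (oracle_prog (d.-tuple R) R).
Implicit Types (f g : d.-tuple R -> R) (t : R) (u : {set 'I_d}).

Definition weight_prog t f g (x : d.-tuple R) : prog R :=
  Query x (fun v => Done ((t < v)%R%:R * f x / g x)).

Definition p_prog t f g {N} (x : 'I_N -> d.-tuple R) : prog R :=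
  bind (traverse (fun n => weight_prog t f g (x n))) (fun W =>
    Done (mean (tnth W))).

Definition TEV_prog t f g u {N Nu NI} (x : 'I_N -> d.-tuple R)
    (y : 'I_Nu -> #|~: u|.-tuple R) (z : 'I_Nu -> 'I_NI -> #|u|.-tuple R) :
    prog R :=
  bind (p_prog t f g x) (fun p =>
    bind (traverse (fun n => traverse (fun k =>
            weight_prog t f g (glue (z n k) (y n))))) (fun W =>
      Done (TEV_of_weights p (fun n k => tnth (tnth W n) k)
              (fun n => marginal_ratio f g u (y n))))).

End estimation_programs.
Arguments TEV_prog {R d} t f g u {N Nu NI} x y z.

(* Main.v *)
(** The conditional probability [c(y) = P(phi(X) > t | X_{-u} = y)] is the quotient
    of the marginal densities of [1_A f] and of [f], where [A = {phi > t}], so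
    [TEV_u = P(A) - E (c(X_{-u})^2)].  Writing [W_k] for the weights attached to the
    same [Y = X_{-u}^(n)], the subtracted bias term turns the square of the mean of
    the [W_k] into the average of [W_k W_l] over the pairs [k <> l], which are
    conditionally independent given [Y].  As [w g = 1_A f], the conditional mean of
    a weight is [c(Y) f_{-u}(Y) / g_{-u}(Y)], and the factor [g_{-u} / f_{-u}] makes
    the expectation of each such product equal to [E (c(X_{-u})^2)]. *)

Require Import Defs.
From HB Require Import structures.
From mathcomp Require Import all_boot all_order all_algebra.
From mathcomp Require Import all_classical all_reals all_analysis.
From mathcomp Require Import measurable_realfun ring lra.

Set Implicit Arguments.
Unset Strict Implicit.
Unset Printing Implicit Defensive.

Import Order.TTheory GRing.Theory Num.Theory.
Import numFieldNormedType.Exports.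

Local Open Scope classical_set_scope.
Local Open Scope ring_scope.

(** * Measures with densities *)

(** The squares [W_k^2] may have infinite expectation even after weighting by the ratio of
    marginals. Only their cancellation makes the estimator integrable, so the algebra has to precede
    every expectation. Expectations are then computed by Tonelli as integrals of nonnegative
    functions, and integrability is read off from the values, which are finite because [P(A)] and
    [E c^2] are at most 1. The other obstacle is division. A quotient is 0 at a zero denominator and
    a diverging marginal is read as 0, so the identities between marginals hold only almost
    everywhere and the zeros need a reason: the marginal of [1_A f] vanishes where [f_{-u}] does
    because [1_A f <= f], and where [g_{-u}] does because [g > 0] wherever [1_A f > 0]. *)

Section measures_with_densities.
Context {R : realType}.
Local Open Scope ereal_scope.
Import HBNNSimple.

(** Both sides are limits, by monotone convergence, of integrals of simple functions increasing to
    [F], so indicators suffice. Finiteness of [h] lets the limit pass through the product with [h x]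
    even where [F x] is infinite. *)
Lemma ge0_integral_density {d} {T : measurableType d}
    (nu mu : {measure set T -> \bar R}) (h F : T -> \bar R) :
  measurable_fun setT h -> (forall x, 0 <= h x) -> (forall x, h x \is a fin_num) ->
  (forall A, measurable A -> nu A = \int[mu]_(x in A) h x) ->
  measurable_fun setT F -> (forall x, 0 <= F x) ->
  \int[nu]_x F x = \int[mu]_x (F x * h x).
Proof.
move=> mh h0 hfin nuE mF F0; pose s := nnsfun_approx measurableT mF.
have FE x : F x = lim ((EFin \o s n) x @[n --> \oo]).
  by apply/esym/cvg_lim => //; exact: cvg_nnsfun_approx.
have ndsE x : nondecreasing_seq ((EFin \o s ^~ x) : nat -> \bar R).
  by move=> a b ab; rewrite lee_fin; exact/lefP/nd_nnsfun_approx.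
have -> : \int[nu]_x F x = lim (\int[nu]_x (EFin \o s n) x @[n --> \oo]).
  under eq_integral => x _ do rewrite FE.
  apply: monotone_convergence => //.
  - by move=> n; apply/measurable_EFinP; exact/measurable_funP.
  - by move=> n x _ //=; rewrite lee_fin.
  - by move=> x _; exact: ndsE.
have -> : \int[mu]_x (F x * h x) =
    lim (\int[mu]_x ((EFin \o s n) x * h x) @[n --> \oo]).
  have Fh x : F x * h x = lim ((EFin \o s n) x * h x @[n --> \oo]).
    by apply/esym/cvg_lim => //; apply: cvgeZr => //; exact: cvg_nnsfun_approx.
  under eq_integral => x _ do rewrite Fh.
  apply: monotone_convergence => //.
  - move=> n; apply/emeasurable_funM => //.
    by apply/measurable_EFinP.
  - by move=> n x _ /=; rewrite mule_ge0 ?lee_fin.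
  - by move=> x _ a b ab/=; rewrite lee_wpmul2r//; exact: ndsE.
suff suf n : \int[mu]_x ((EFin \o s n) x * h x) = \int[nu]_x (EFin \o s n) x.
  by under eq_fun do rewrite -suf.
transitivity (\int[nu]_x
   (\sum_(y \in range (s n)) (y * \1_(s n @^-1` [set y]) x)%:E)); last first.
  by apply: eq_integral => t tE; rewrite /= fimfunE -fsumEFin.
have indich m r : measurable_fun setT (fun x => (r * \1_(s m @^-1` [set r]) x)%:E).
  by apply: (measurable_comp measurableT) => //; exact: measurable_funM.
rewrite ge0_integral_fsum//; last by move=> m y Ey; exact: nnfun_muleindic_ge0.
transitivity (\int[mu]_x (\sum_(y \in range (s n))
    (y * \1_(s n @^-1` [set y]) x)%:E * h x)).
  under [RHS]eq_integral => x xE.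
    rewrite -ge0_mule_fsuml => [|y]; last exact: nnfun_muleindic_ge0.
    rewrite fsumEFin // -(fimfunE _ x); over.
  by [].
rewrite ge0_integral_fsum//; last 2 first.
  - by move=> y; apply: emeasurable_funM.
  - by move=> m y Ey; rewrite mule_ge0// nnfun_muleindic_ge0.
apply: eq_fsbigr => r rhn.
under [RHS]eq_integral do rewrite EFinM.
rewrite integralZl_indic_nnsfun => //.
under eq_integral do rewrite EFinM -muleA.
rewrite ge0_integralZl//.
- under eq_integral do rewrite muleC.
  rewrite (eq_integral (h \_ (s n @^-1` [set r]))); last first.
    by move=> x xE; rewrite epatch_indic.
  by rewrite -integral_mkcond -nuE// integral_indic// setIT.
- by apply: emeasurable_funM => //; exact/measurable_EFinP.
- by move=> t Et; rewrite mule_ge0 ?lee_fin.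
- by move: rhn; rewrite inE => -[t _ <-]; rewrite lee_fin.
Qed.

Lemma density_measure_exists {d} {T : measurableType d}
    (mu : {measure set T -> \bar R}) (h : T -> \bar R) :
  measurable_fun setT h -> (forall x, 0 <= h x) ->
  exists nu : {measure set T -> \bar R}, forall A, nu A = \int[mu]_(x in A) h x.
Proof.
move=> mh h0; pose nu A := \int[mu]_(x in A) h x.
have nu0 : nu set0 = 0 by rewrite /nu integral_set0.
have nu_ge0 A : 0 <= nu A by exact: integral_ge0.
have nuD : semi_sigma_additive nu by exact: semi_sigma_additive_nng_induced.
pose nuM : {measure set T -> \bar R} :=
  HB.pack nu (isMeasure.Build _ _ _ nu nu0 nu_ge0 nuD).
by exists nuM.
Qed.

Lemma pushforward_measure_exists {d d'} {O : measurableType d}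
    {T : measurableType d'} (m : {measure set O -> \bar R}) (V : O -> T) :
  measurable_fun setT V ->
  exists nu : {measure set T -> \bar R}, forall A, nu A = m (V @^-1` A).
Proof.
move=> mV.
unshelve refine (ex_intro _
  ((pushforward m V : set T -> \bar R) : {measure set T -> \bar R}) _) => //.
Qed.

End measures_with_densities.

(** * Joint laws of two and three random elements *)

Section joint_laws.
Context {R : realType}.
Local Open Scope ereal_scope.

Lemma ge0_integral_law {d d'} {O : measurableType d} {T : measurableType d'}
    (m : {measure set O -> \bar R}) (mu : {measure set T -> \bar R})
    (V : O -> T) (h F : T -> \bar R) :
  measurable_fun setT V ->
  measurable_fun setT h -> (forall x, 0 <= h x) -> (forall x, h x \is a fin_num) ->
  (forall A, measurable A -> m (V @^-1` A) = \int[mu]_(x in A) h x) ->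
  measurable_fun setT F -> (forall x, 0 <= F x) ->
  \int[m]_w F (V w) = \int[mu]_x (F x * h x).
Proof.
move=> mV mh h0 hfin VE mF F0.
have [nu nuE] := pushforward_measure_exists m mV.
rewrite -(@ge0_integral_density _ _ _ nu)//; last first.
  by move=> A mA; rewrite nuE VE.
rewrite -[LHS](ge0_integral_pushforward mV m measurableT mF)//.
by apply: eq_measure_integral => A mA _; rewrite nuE.
Qed.

(** Rectangles form a pi-system generating the product sigma-algebra; since [m1] is finite, the
    constant sequence [setT] serves as the exhaustion. *)
Lemma measure_prod_unique {d1 d2} {T1 : measurableType d1} {T2 : measurableType d2}
    (m1 m2 : {measure set (T1 * T2) -> \bar R}) :
  m1 setT < +oo ->
  (forall A B, measurable A -> measurable B -> m1 (A `*` B) = m2 (A `*` B)) ->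
  forall C, measurable C -> m1 C = m2 C.
Proof.
move=> m1oo m12.
pose G : set (set (T1 * T2)) := [set A `*` B | A in measurable & B in measurable].
apply: (measure_unique G (fun=> setT)) => //.
- exact: measurable_prod_measurableType.
- move=> _ _ [A mA [B mB <-]] [A' mA' [B' mB' <-]].
  exists (A `&` A'); first exact: measurableI.
  by exists (B `&` B'); [exact: measurableI|rewrite setXI].
- by move=> _; exists setT => //; exists setT => //; rewrite setXTT.
- by apply/seteqP; split=> // x _; exists 0%N.
- by move=> _ [A mA [B mB <-]]; exact: m12.
Qed.

Lemma ge0_integral_setX {d1 d2} {T1 : measurableType d1} {T2 : measurableType d2}
    (mu1 : {sigma_finite_measure set T1 -> \bar R})
    (mu2 : {sigma_finite_measure set T2 -> \bar R}) (h : T1 * T2 -> \bar R) A B :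
  measurable_fun setT h -> (forall x, 0 <= h x) -> measurable A -> measurable B ->
  \int[mu1 \x mu2]_(z in A `*` B) h z =
  \int[mu1]_(x in A) \int[mu2]_(y in B) h (x, y).
Proof.
move=> mh h0 mA mB; rewrite integral_mkcond fubini_tonelli1//.
- rewrite [RHS]integral_mkcond; apply: eq_integral => x _; rewrite /fubini_F patchE.
  case: ifPn => [xA|xA]; last first.
    by apply: integral0_eq => y _; rewrite patchE in_setX/= (negbTE xA).
  rewrite [RHS]integral_mkcond; apply: eq_integral => y _.
  by rewrite !patchE in_setX/= xA.
- exact: ((measurable_restrictT _ (measurableX mA mB)).1 (measurable_funTS mh)).
- by move=> z; rewrite patchE; case: ifP.
Qed.

(** The law of the pair and the measure with density [h] agree on rectangles, by [VE] and
    Tonelli. *)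
Lemma joint_density {d d1 d2} {O : measurableType d}
    {T1 : measurableType d1} {T2 : measurableType d2}
    (m : {measure set O -> \bar R})
    (mu1 : {sigma_finite_measure set T1 -> \bar R})
    (mu2 : {sigma_finite_measure set T2 -> \bar R})
    (V1 : O -> T1) (V2 : O -> T2) (h : T1 * T2 -> \bar R) :
  m setT < +oo -> measurable_fun setT V1 -> measurable_fun setT V2 ->
  measurable_fun setT h -> (forall x, 0 <= h x) ->
  (forall A B, measurable A -> measurable B ->
    m (V1 @^-1` A `&` V2 @^-1` B) =
    \int[mu1]_(x in A) \int[mu2]_(y in B) h (x, y)) ->
  forall C, measurable C ->
    m ((fun w => (V1 w, V2 w)) @^-1` C) = \int[mu1 \x mu2]_(z in C) h z.
Proof.
move=> moo mV1 mV2 mh h0 VE C mC.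
have mV : measurable_fun setT (fun w => (V1 w, V2 w)) by exact: measurable_fun_pair.
have [nu1 nu1E] := pushforward_measure_exists m mV.
have [nu2 nu2E] := density_measure_exists (mu1 \x mu2) mh h0.
rewrite -nu1E -nu2E; apply: measure_prod_unique => //; first by rewrite nu1E.
by move=> A B mA mB; rewrite nu1E nu2E ge0_integral_setX// -VE.
Qed.

(* The canonical sigma-finite structure that the library declares on [mu1 \x mu2]
   is not found by unification. *)
Lemma product_sigma_finite_exists {d1 d2} {T1 : measurableType d1}
    {T2 : measurableType d2} (mu1 : {sigma_finite_measure set T1 -> \bar R})
    (mu2 : {sigma_finite_measure set T2 -> \bar R}) :
  exists mu : {sigma_finite_measure set (T1 * T2)%type -> \bar R},
    (mu : set (T1 * T2) -> \bar R) = mu1 \x mu2.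
Proof.
have [F [FT ndF mF]] := (sigma_finiteP setT mu1).1 (sigma_finiteT mu1).
have [G [GT ndG mG]] := (sigma_finiteP setT mu2).1 (sigma_finiteT mu2).
have sf : sigma_finite setT (mu1 \x mu2).
  exists (fun k => F k `*` G k) => [|k].
    apply/seteqP; split=> // -[x y] _.
    have [[i _ Fi] [j _ Gj]] : (\bigcup_i F i) x /\ (\bigcup_i G i) y.
      by rewrite -FT -GT.
    exists (maxn i j) => //; split => /=.
      by have /subsetPset := ndF _ _ (leq_maxl i j); apply.
    by have /subsetPset := ndG _ _ (leq_maxr i j); apply.
  have [[mFk Fk] [mGk Gk]] := (mF k, mG k).
  split; first exact: measurableX.
  by rewrite product_measure1E// lte_mul_pinfty// ge0_fin_numE.
pose mu : {measure set (T1 * T2)%type -> \bar R} := mu1 \x mu2.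
pose nu : {sigma_finite_measure set (T1 * T2)%type -> \bar R} :=
  HB.pack (Measure.sort mu) (@Measure_isSigmaFinite.Build _ _ _ mu sf).
by exists nu.
Qed.

Lemma ge0_integral_law3 {d d1 d2 d3} {O : measurableType d} {T1 : measurableType d1}
    {T2 : measurableType d2} {T3 : measurableType d3}
    (m : {measure set O -> \bar R})
    (mu1 : {sigma_finite_measure set T1 -> \bar R})
    (mu2 : {sigma_finite_measure set T2 -> \bar R})
    (mu3 : {sigma_finite_measure set T3 -> \bar R})
    (V1 : O -> T1) (V2 : O -> T2) (V3 : O -> T3) (h F : (T1 * T2) * T3 -> \bar R) :
  m setT < +oo -> measurable_fun setT V1 -> measurable_fun setT V2 ->
  measurable_fun setT V3 -> measurable_fun setT h -> (forall x, 0 <= h x) ->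
  (forall x, h x \is a fin_num) ->
  (forall A B C, measurable A -> measurable B -> measurable C ->
    m (V1 @^-1` A `&` V2 @^-1` B `&` V3 @^-1` C) =
    \int[mu1]_(x in A) \int[mu2]_(y in B) \int[mu3]_(z in C) h (x, y, z)) ->
  measurable_fun setT F -> (forall x, 0 <= F x) ->
  \int[m]_w F (V1 w, V2 w, V3 w) =
  \int[mu1]_x \int[mu2]_y \int[mu3]_z (F (x, y, z) * h (x, y, z)).
Proof.
move=> moo mV1 mV2 mV3 mh h0 hfin VE mF F0.
have [mu12 mu12E] := product_sigma_finite_exists mu1 mu2.
have mV12 : measurable_fun setT (fun w => (V1 w, V2 w)) by exact: measurable_fun_pair.
have mV : measurable_fun setT (fun w => (V1 w, V2 w, V3 w)) by exact: measurable_fun_pair.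
have JE D : measurable D -> m ((fun w => (V1 w, V2 w, V3 w)) @^-1` D) =
    \int[mu12 \x mu3]_(z in D) h z.
  move=> mD; apply: (joint_density moo mV12 mV3 mh h0 _ mD) => E C mE mC.
  have mVC : measurable (V3 @^-1` C) by rewrite -[X in measurable X]setTI; exact: mV3.
  have mhC : measurable_fun setT (fun p => \int[mu3]_(z in C) h (p, z)).
    pose k := h \_ (setT `*` C).
    have -> : (fun p => \int[mu3]_(z in C) h (p, z)) = fubini_F mu3 k.
      apply/funext => p; rewrite integral_mkcond; apply: eq_integral => z _.
      by rewrite /k !patchE in_setX in_setT.
    apply: measurable_fun_fubini_tonelli_F.
      apply: (measurable_restrictT _ (measurableX measurableT mC)).1.
      exact: measurable_funTS.
    by move=> z; rewrite /k patchE; case: ifP.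
  (* With [C] fixed, [m] restricted to the event that [V3] lies in [C] gives [(V1, V2)] the density
     [\int[mu3]_(z in C) h (p, z)] at [p]: the two-variable lemma is applied a second time, to this
     restricted measure. *)
  have mCoo : mrestr m mVC setT < +oo.
    by rewrite /mrestr setTI (le_lt_trans _ moo)// le_measure// inE.
  rewrite mu12E; apply: (joint_density mCoo mV1 mV2 mhC _ _ mE).
  - by move=> p; exact: integral_ge0.
  - by move=> A B mA mB; rewrite -VE.
rewrite (ge0_integral_law mV mh h0 hfin JE mF F0).
have mFh : measurable_fun setT (fun x => F x * h x) by exact: emeasurable_funM.
have Fh0 x : 0 <= F x * h x by rewrite mule_ge0.
rewrite fubini_tonelli1// mu12E fubini_tonelli1//.
- exact: measurable_fun_fubini_tonelli_F.
- by move=> p; exact: integral_ge0.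
Qed.

End joint_laws.

(** * Splitting the coordinates *)

Section gluing.
Context {R : realType}.

(** The total inverse has value 0 at 0, where it is not continuous; so 0 is split off as a single
    point and continuity is used on the rest. *)
Lemma measurable_inv : measurable_fun setT (@GRing.inv R).
Proof.
have -> : [set: R] = [set 0] `|` ~` [set 0] by rewrite setUv.
apply/measurable_funU => //; first exact: measurableC.
split; first exact: measurable_fun_set1.
apply: subspace_continuous_measurable_fun; first exact: measurableC.
rewrite continuous_subspace_in => x; rewrite inE /= => x0.
apply: continuous_subspaceT_for => //.
by apply: inv_continuous; apply/eqP.
Qed.

Lemma measurable_box n (A : 'I_n -> set (measurableTypeR R)) :
  (forall i, measurable (A i)) ->
  measurable [set x : n.-tuple R | forall i, A i (tnth x i)].
Proof.
move=> mA; rewrite (_ : [set _ | _] =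
    \bigcap_(i in [set: 'I_n]) ((@tnth n R)^~ i @^-1` A i)).
  apply: fin_bigcap_measurable => // i _; rewrite -[X in measurable X]setTI.
  exact: (@measurable_tnth _ R n i measurableT _ (mA _)).
by apply/seteqP; split=> [x h i _|x h i]; exact: h.
Qed.

(** Boxes form a pi-system, and they generate the sigma-algebra because the preimage of a set under
    one coordinate is the box whose other sides are full. *)
Lemma lebesgue_tuple_unique n (m : {measure set (n.-tuple R) -> \bar R}) :
  (forall A : 'I_n -> set (measurableTypeR R), (forall i, measurable (A i)) ->
    m [set x | forall i, A i (tnth x i)] = (\prod_(i < n) lebesgue_measure (A i))%E) ->
  forall B, measurable B -> lebesgue_tuple n B = m B.
Proof.
move=> mE.
pose box (A : 'I_n -> set (measurableTypeR R)) : set (n.-tuple R) :=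
  [set x : n.-tuple R | forall i, A i (tnth x i)].
pose G := [set box A | A in [set A | forall i, measurable (A i)]].
pose I (k : nat) : set (measurableTypeR R) := `](- k%:R), k%:R]%classic.
apply: (measure_unique G (fun k => box (fun=> I k))).
- apply/seteqP; split; last first.
    apply: smallest_sub; first exact: sigma_algebra_measurable.
    by move=> _ [A mA <-]; exact: measurable_box.
  apply: smallest_sub; first exact: smallest_sigma_algebra.
  move=> B; rewrite -bigcup_seq /= => -[i _ [A mA <-]].
  apply: sub_sigma_algebra; exists (fun j => if j == i then A else setT).
    by move=> j /=; case: ifP.
  rewrite setTI; apply/seteqP; split=> x /=.
    by move=> /(_ i); rewrite eqxx.
  by move=> xA j; case: eqP => // ->.
- move=> _ _ [A mA <-] [B mB <-]; exists (fun i => A i `&` B i).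
    by move=> i; exact: measurableI.
  apply/seteqP; split=> x /=; first by move=> h; split=> i; case: (h i).
  by move=> [hA hB] i; split.
- by move=> k; exists (fun=> I k) => // i; exact: measurable_itv.
- apply/seteqP; split=> // x _.
  (* [M] bounds every coordinate; the successor of its truncation exceeds [M] strictly, as the
     left-open sides []-k, k]] require. *)
  pose M : R := \sum_(i < n) `|tnth x i|.
  have xM i : `|tnth x i| <= M.
    by rewrite /M (bigD1 i)//= lerDl sumr_ge0.
  exists (Num.truncn M).+1 => // i; rewrite /I /= in_itv/=.
  have := xM i; rewrite ler_norml => /andP[Mx xM'].
  have Mlt := truncnS_gt M.
  by apply/andP; split; lra.
- by move=> _ [A mA <-]; rewrite mE//; exact: lebesgue_tuple_box.
- move=> k; apply: (@eq_ind_r _ _ (fun x => (x < +oo)%E) _ _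
    (@lebesgue_tuple_box R n (fun=> I k) (fun=> measurable_itv _))).
  rewrite ltey_eq; apply/orP; left; elim/big_ind : _ => //.
    by move=> x y; exact: fin_numM.
  move=> i _; rewrite /I lebesgue_measure_itv /=; case: ifP => // _.
Qed.

End gluing.

(** * Lebesgue measure under the splitting into the coordinates [u] and [-u] *)

Section split_coordinates.
Context {R : realType} {d : nat} (u : {set 'I_d}).
Local Notation lam := (lebesgue_tuple (R := R)).

Lemma measurable_subvec (v : {set 'I_d}) :
  measurable_fun setT (subvec v : d.-tuple R -> _).
Proof.
apply/measurable_fun_tnthP => i.
rewrite (_ : _ \o _ = (@tnth d R)^~ (enum_val i)); first exact: measurable_tnth.
by apply/funext => x /=; rewrite tnth_mktuple.
Qed.

(** [glue] reads its entries by [nth] with default 0; for [i] in [v] the default is never reached,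
    and the entry sits at the rank of [i] in [v]. *)
Lemma nth_enum_rank (v : {set 'I_d}) i (vi : i \in v) (x : #|v|.-tuple R) :
  nth 0 x (index i (enum v)) = tnth x (enum_rank_in vi i).
Proof.
rewrite -{1}(enum_rankK_in vi vi) (enum_val_nth i) index_uniq ?enum_uniq -?cardE//.
by rewrite -tnth_nth.
Qed.

Lemma tnth_gluel i (iu : i \in u) x y :
  tnth (Defs.glue x y) i = tnth x (enum_rank_in iu i) :> R.
Proof. by rewrite tnth_mktuple iu nth_enum_rank. Qed.

Lemma tnth_gluer i (iu : i \in ~: u) x y :
  tnth (Defs.glue x y) i = tnth y (enum_rank_in iu i) :> R.
Proof.
rewrite tnth_mktuple ifN; last by move: iu; rewrite finset.in_setC.
exact: nth_enum_rank.
Qed.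

Lemma measurable_glue d' (T : measurableType d') (a : T -> #|u|.-tuple R)
    (b : T -> #|~: u|.-tuple R) :
  measurable_fun setT a -> measurable_fun setT b ->
  measurable_fun setT (fun x => Defs.glue (a x) (b x)).
Proof.
move=> ma mb; apply/measurable_fun_tnthP => i.
have [iu|iu] := boolP (i \in u).
  rewrite (_ : _ \o _ = (fun x => tnth (a x) (enum_rank_in iu i))).
    exact: (measurableT_comp (measurable_tnth _)).
  by apply/funext => x /=; rewrite tnth_gluel.
have iuC : i \in ~: u by rewrite finset.in_setC.
rewrite (_ : _ \o _ = (fun x => tnth (b x) (enum_rank_in iuC i))).
  exact: (measurableT_comp (measurable_tnth _)).
by apply/funext => x /=; rewrite tnth_gluer.
Qed.

(** By [lebesgue_tuple_unique], Lebesgue measure is the image of the product measure under [glue]: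
    both give a box the product of the measures of its sides, grouped into [u] and its complement.
    Change of variables and Tonelli finish. *)
Lemma ge0_integral_glue (F : d.-tuple R -> \bar R) :
  measurable_fun setT F -> (forall x, 0 <= F x)%E ->
  (\int[lam d]_x F x =
   \int[lam #|~: u|]_y \int[lam #|u|]_x F (Defs.glue x y))%E.
Proof.
move=> mF F0.
pose gl (p : #|u|.-tuple R * #|~: u|.-tuple R) := Defs.glue p.1 p.2.
have mgl : measurable_fun setT gl by exact: measurable_glue.
have [m mE] := pushforward_measure_exists (lam #|u| \x lam #|~: u|)%E mgl.
have lamE B : measurable B -> lam d B = m B.
  apply: lebesgue_tuple_unique => A mA; rewrite mE.
  rewrite (_ : _ @^-1` _ = [set x | forall i, A (enum_val i) (tnth x i)] `*`
      [set y | forall i, A (enum_val i) (tnth y i)]); last first.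
    apply/seteqP; split=> -[x y] /=.
      move=> h; split=> i; have := h (enum_val i).
        by rewrite /gl/= (tnth_gluel (enum_valP i)) enum_valK_in.
      by rewrite /gl/= (tnth_gluer (enum_valP i)) enum_valK_in.
    move=> [hx hy] i; rewrite /gl/=; have [iu|iu] := boolP (i \in u).
      by rewrite (tnth_gluel iu); have := hx (enum_rank_in iu i); rewrite enum_rankK_in.
    have iuC : i \in ~: u by rewrite finset.in_setC.
    by rewrite (tnth_gluer iuC); have := hy (enum_rank_in iuC i); rewrite enum_rankK_in.
  have mAe (v : {set 'I_d}) (i : 'I_#|v|) : measurable (A (enum_val i)) by [].
  have mbox v := measurable_box (fun i => mAe v i).
  have boxE (v : {set 'I_d}) : lam #|v| [set x | forall i, A (enum_val i) (tnth x i)] =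
      (\prod_(i in v) lebesgue_measure (A i))%E.
    rewrite (lebesgue_tuple_box (mAe v)).
    exact/esym/(@big_enum_val _ _ _ _ (mem v)).
  rewrite [LHS](product_measure1E (lam #|u|) (lam #|~: u|) (mbox u) (mbox (~: u))).
  rewrite [RHS](bigID (mem u))/= (_ : (\prod_(i | i \notin u) _)%E =
      (\prod_(i in ~: u) lebesgue_measure (A i))%E).
    exact: f_equal2 (boxE u) (boxE (~: u)).
  by apply: eq_bigl => i; rewrite finset.in_setC.
transitivity (\int[lam #|u| \x lam #|~: u|]_p F (gl p))%E; last first.
  by rewrite fubini_tonelli2//; exact: measurableT_comp.
rewrite -[RHS](ge0_integral_pushforward mgl _ measurableT mF)//.
by apply: eq_measure_integral => A mA _; exact: etrans (lamE _ mA) (mE _).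
Qed.

End split_coordinates.

(** * Marginal densities and conditional probabilities *)

Section marginals.
Context {R : realType} {d : nat} (u : {set 'I_d}).
Local Open Scope ereal_scope.
Implicit Types h : d.-tuple R -> R.

Definition emarginal h (y : #|~: u|.-tuple R) : \bar R :=
  \int[lebesgue_tuple #|u|]_x (h (Defs.glue x y))%:E.

Lemma marginalCE h y : marginalC u h y = fine (emarginal h y).
Proof. by []. Qed.

Lemma emarginal_ge0 h y : (forall x, 0 <= h x)%R -> 0 <= emarginal h y.
Proof. by move=> h0; apply: integral_ge0 => x _; rewrite lee_fin. Qed.

Lemma marginalC_ge0 h y : (forall x, 0 <= h x)%R -> (0 <= marginalC u h y)%R.
Proof. by move=> h0; rewrite marginalCE fine_ge0// emarginal_ge0. Qed.

Lemma measurable_emarginal h : measurable_fun setT h -> (forall x, 0 <= h x)%R ->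
  measurable_fun setT (emarginal h).
Proof.
move=> mh h0.
apply: (@measurable_fun_fubini_tonelli_G _ _ _ _ _ (lebesgue_tuple #|u|)
    (fun p : #|u|.-tuple R * #|~: u|.-tuple R => (h (Defs.glue p.1 p.2))%:E)).
  by apply/measurable_EFinP; apply: measurableT_comp => //; exact: measurable_glue.
by move=> p; rewrite lee_fin.
Qed.

Lemma measurable_marginalC h : measurable_fun setT h -> (forall x, 0 <= h x)%R ->
  measurable_fun setT (marginalC u h).
Proof.
move=> mh h0; apply: measurableT_comp => //; exact: measurable_emarginal.
Qed.

Lemma integral_emarginal h : measurable_fun setT h -> (forall x, 0 <= h x)%R ->
  \int[lebesgue_tuple #|~: u|]_y emarginal h y = \int[lebesgue_tuple d]_x (h x)%:E.
Proof.
move=> mh h0; apply/esym/(ge0_integral_glue u); first exact/measurable_EFinP.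
by move=> x; rewrite lee_fin.
Qed.

Lemma emarginal_fin_num_ae h : measurable_fun setT h -> (forall x, 0 <= h x)%R ->
  \int[lebesgue_tuple d]_x (h x)%:E < +oo ->
  {ae lebesgue_tuple #|~: u|, forall y, emarginal h y \is a fin_num}.
Proof.
move=> mh h0 hoo.
have : (lebesgue_tuple #|~: u|).-integrable setT (emarginal h).
  apply/integrableP; split; first exact: measurable_emarginal.
  under eq_integral do rewrite gee0_abs ?emarginal_ge0//.
  by rewrite integral_emarginal.
move/(integrable_ae measurableT); apply: filterS => y; exact.
Qed.

Lemma le_emarginal h1 h2 y : measurable_fun setT h1 -> measurable_fun setT h2 ->
  (forall x, 0 <= h1 x)%R -> (forall x, h1 x <= h2 x)%R ->
  emarginal h1 y <= emarginal h2 y.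
Proof.
move=> m1 m2 h10 h12; apply: ge0_le_integral => //.
- by move=> x _; rewrite lee_fin.
- by apply/measurable_EFinP; apply: measurableT_comp => //; exact: measurable_glue.
- by apply/measurable_EFinP; apply: measurableT_comp => //; exact: measurable_glue.
- by move=> x _; rewrite lee_fin.
Qed.

(** A vanishing integral of [h2] over the fibre above [y] means [h2 = 0] almost everywhere there,
    hence [h1 = 0]. This covers the points [y] where the marginal of [g] is zero. *)
Lemma emarginal_eq0 h1 h2 y : measurable_fun setT h1 -> measurable_fun setT h2 ->
  (forall x, 0 <= h1 x)%R -> (forall x, 0 <= h2 x)%R ->
  (forall x, 0 < h1 x -> 0 < h2 x)%R ->
  emarginal h2 y = 0 -> emarginal h1 y = 0.
Proof.
move=> m1 m2 h10 h20 h12 h2y.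
have mg h : measurable_fun setT h ->
    measurable_fun setT (fun x => (h (Defs.glue x y))%:E).
  move=> mh; apply/measurable_EFinP; apply: measurableT_comp => //.
  exact: measurable_glue.
have abs0 h : (forall x, 0 <= h x)%R ->
    emarginal h y = \int[lebesgue_tuple #|u|]_x `|(h (Defs.glue x y))%:E|.
  by move=> h0; apply: eq_integral => x _; rewrite gee0_abs ?lee_fin.
have /ae_eq_integral_abs h2ae : \int[lebesgue_tuple #|u|]_x `|(h2 (Defs.glue x y))%:E| = 0.
  by rewrite -abs0.
rewrite abs0//; apply/ae_eq_integral_abs => //; first exact: mg.
have := h2ae measurableT (mg _ m2); apply: filterS => x /= /(_ I) [h2x] _.
congr EFin; apply/eqP; rewrite eq_le h10 andbT leNgt; apply/negP => /h12.
by rewrite h2x ltxx.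
Qed.

End marginals.
Arguments emarginal {R d} u h y.

(** * Conditional probability as a quotient of marginals *)

Section conditional_probability.
Context {R : realType} {d : nat} (u : {set 'I_d}).
Variables (f : d.-tuple R -> R) (A : set (d.-tuple R)).
Hypotheses (mf : measurable_fun setT f) (f0 : forall x, 0 <= f x).
Hypothesis f1 : (\int[lebesgue_tuple d]_x (f x)%:E = 1)%E.
Hypothesis mA : measurable A.

Let a x := \1_A x * f x.

Let ma : measurable_fun setT a.
Proof. by apply: measurable_funM => //; exact: measurable_indic. Qed.

Let a0 x : 0 <= a x.
Proof. by rewrite mulr_ge0. Qed.

Let af x : a x <= f x.
Proof. by rewrite /a indicE; case: (x \in A); rewrite ?mul1r// mul0r. Qed.

Definition cond_prob (y : #|~: u|.-tuple R) : R := marginalC u a y / marginalC u f y.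

Lemma measurable_cond_prob : measurable_fun setT cond_prob.
Proof.
apply: measurable_funM; first exact: measurable_marginalC.
by apply: measurableT_comp; [exact: measurable_inv|exact: measurable_marginalC].
Qed.

Lemma cond_prob_ge0 y : 0 <= cond_prob y.
Proof. by rewrite divr_ge0// marginalC_ge0. Qed.

Lemma cond_prob_le1 y : cond_prob y <= 1.
Proof.
have [F0|Fpos] := eqVneq (marginalC u f y) 0; first by rewrite /cond_prob F0 invr0 mulr0.
have Fge : 0 < marginalC u f y by rewrite lt_def Fpos marginalC_ge0.
rewrite /cond_prob ler_pdivrMr// mul1r.
(* [fine] sends infinite values to 0, so a nonzero [marginalC] certifies that the integral is
   finite. *)
have Ffin : emarginal u f y \is a fin_num.
  move: Fpos; rewrite marginalCE; case: (emarginal u f y) => //=; rewrite eqxx//.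
rewrite !marginalCE fine_le// ?le_emarginal//.
rewrite ge0_fin_numE ?emarginal_ge0// (le_lt_trans (le_emarginal _ ma mf a0 af))//.
by rewrite ltey_eq Ffin.
Qed.

(** The points where the marginal of [f] diverges form a null set. Where it is 0 the quotient is 0,
    and so is the marginal of [a], because [a <= f]. *)
Lemma cond_probM_ae : {ae lebesgue_tuple #|~: u|, forall y,
  ((cond_prob y)%:E * emarginal u f y = emarginal u a y)%E}.
Proof.
have /(_ f mf f0) := @emarginal_fin_num_ae R d u; rewrite f1 ltry => /(_ isT).
apply: filterS => y Ffin.
have afin : emarginal u a y \is a fin_num.
  rewrite ge0_fin_numE ?emarginal_ge0// (le_lt_trans (le_emarginal _ ma mf a0 af))//.
  by rewrite ltey_eq Ffin.
rewrite -[emarginal u f y]fineK// -[RHS]fineK// -EFinM -!marginalCE; congr EFin.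
have [F0|F0] := eqVneq (marginalC u f y) 0; last by rewrite divfK.
rewrite F0 mulr0; apply/esym/eqP; rewrite eq_le marginalC_ge0// andbT -F0.
by rewrite !marginalCE fine_le// le_emarginal.
Qed.

Variables (dO : measure_display) (O : measurableType dO) (P : probability O R).
Variable X : {RV P >-> d.-tuple R}.
Hypothesis X_density : has_density P X f.

(** [Phi] is constant on each fibre and leaves the inner integral. With [b = 1] this gives the law
    of [X_{-u}], with [b = \1_A] the pairing with the event. *)
Lemma ge0_integral_subvec (Phi : #|~: u|.-tuple R -> R) (b : d.-tuple R -> R) :
  measurable_fun setT Phi -> (forall y, 0 <= Phi y) ->
  measurable_fun setT b -> (forall x, 0 <= b x) ->
  (\int[P]_w (Phi (subvec (~: u) (X w)) * b (X w))%:E =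
   \int[lebesgue_tuple #|~: u|]_y ((Phi y)%:E * emarginal u (fun x => b x * f x)%R y))%E.
Proof.
move=> mPhi Phi0 mb b0.
have mPhiS : measurable_fun setT (fun x => Phi (subvec (~: u) x)).
  by apply: measurableT_comp => //; exact: measurable_subvec.
have -> : (\int[P]_w (Phi (subvec (~: u) (X w)) * b (X w))%:E =
    \int[lebesgue_tuple d]_x ((Phi (subvec (~: u) x) * b x)%:E * (f x)%:E))%E.
  apply: (ge0_integral_law (m := P) (V := X) (h := EFin \o f)
    (F := fun x => (Phi (subvec (~: u) x) * b x)%:E)) => //.
  - exact/measurable_EFinP.
  - by apply/measurable_EFinP; exact: measurable_funM.
  - by move=> x; rewrite lee_fin mulr_ge0.
have mF : measurable_fun setT (fun x => ((Phi (subvec (~: u) x) * b x)%:E * (f x)%:E)%E).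
  by apply/measurable_EFinP; apply: measurable_funM => //; exact: measurable_funM.
rewrite (ge0_integral_glue u mF); last by move=> x; rewrite lee_fin !mulr_ge0.
apply: eq_integral => y _.
have mbf : measurable_fun setT (fun x => b x * f x) by exact: measurable_funM.
rewrite -ge0_integralZl//.
- by apply: eq_integral => x _; rewrite (subvec_glue x y).2 -!EFinM mulrA.
- apply/measurable_EFinP; apply: (measurableT_comp mbf); exact: measurable_glue.
- by move=> x _; rewrite lee_fin mulr_ge0.
- by rewrite lee_fin.
Qed.

(** Tested against all nonnegative [Phi] rather than indicators: the conditional variance needs
    [Phi = \1_B c]. *)
Lemma cond_prob_cond_exp (Phi : #|~: u|.-tuple R -> R) :
  measurable_fun setT Phi -> (forall y, 0 <= Phi y) ->
  (\int[P]_w (Phi (subvec (~: u) (X w)) * cond_prob (subvec (~: u) (X w)))%:E =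
   \int[P]_w (Phi (subvec (~: u) (X w)) * \1_A (X w))%:E)%E.
Proof.
move=> mPhi Phi0.
have mc := measurable_cond_prob.
have mPc : measurable_fun setT (fun y => Phi y * cond_prob y) by exact: measurable_funM.
transitivity (\int[lebesgue_tuple #|~: u|]_y
    ((Phi y * cond_prob y)%:E * emarginal u f y))%E.
  have Pc0 y : 0 <= Phi y * cond_prob y by rewrite mulr_ge0// cond_prob_ge0.
  have H := ge0_integral_subvec mPc Pc0 (measurable_cst (1 : R)) (fun=> ler01).
  apply: etrans (etrans _ H) _; first by apply: eq_integral => w _; rewrite /= mulr1.
  apply: eq_integral => y _; congr (_ * _)%E.
  by apply: eq_integral => x _; rewrite /= mul1r.
rewrite ge0_integral_subvec//.
apply: ge0_ae_eq_integral => //.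
- by apply: emeasurable_funM; [exact/measurable_EFinP|exact: measurable_emarginal].
- by apply: emeasurable_funM; [exact/measurable_EFinP|exact: measurable_emarginal].
- by move=> y _; rewrite mule_ge0 ?emarginal_ge0// lee_fin mulr_ge0// cond_prob_ge0.
- by move=> y _; rewrite mule_ge0 ?emarginal_ge0// lee_fin.
- by have := cond_probM_ae; apply: filterS => y Ey _; rewrite EFinM -muleA Ey.
Qed.

End conditional_probability.
Arguments cond_prob {R d} u f A y.

(** * Conditional variance *)

Section conditional_variance.
Context {R : realType} {d d'} {T : measurableType d} {T' : measurableType d'}.
Variables (P : probability T R) (Z : T -> T') (Y : T -> R) (c : T' -> R).
Hypotheses (mZ : measurable_fun setT Z) (mY : measurable_fun setT Y)
  (mc : measurable_fun setT c).
Hypotheses (Y2 : forall w, Y w ^+ 2 = Y w)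
  (c0 : forall z, 0 <= c z) (c1 : forall z, c z <= 1).
Hypothesis cE : forall Phi : T' -> R, measurable_fun setT Phi ->
  (forall z, 0 <= Phi z) ->
  (\int[P]_w (Phi (Z w) * c (Z w))%:E = \int[P]_w (Phi (Z w) * Y w)%:E)%E.

Let Y0 w : 0 <= Y w.
Proof. by rewrite -Y2 sqr_ge0. Qed.

Let mcZ : measurable_fun setT (fun w => c (Z w)).
Proof. exact: measurableT_comp. Qed.

Let integral_preimage B (k : T -> R) : measurable B ->
  (\int[P]_(w in Z @^-1` B) (k w)%:E = \int[P]_w (\1_B (Z w) * k w)%:E)%E.
Proof.
move=> mB; rewrite integral_mkcond; apply: eq_integral => w _.
rewrite patchE indicE /=; have -> : (w \in Z @^-1` B) = (Z w \in B).
  by apply/idP/idP; rewrite !inE.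
by case: ifP => _; rewrite ?mul1r ?mul0r.
Qed.

Let integrable01 (k : T -> R) : measurable_fun setT k ->
  (forall w, 0 <= k w) -> (forall w, k w <= 1) -> P.-integrable setT (EFin \o k).
Proof.
move=> mk k0 k1; apply: (@le_integrable _ _ _ _ _ _ _ (cst 1%E)) => //.
- exact/measurable_EFinP.
- by move=> w _ /=; rewrite lee_fin normr1 ger0_norm.
- exact: finite_measure_integrable_cst.
Qed.

Let cond_exp_c : is_cond_exp P Z Y c.
Proof.
split=> //; first exact: (integrable01 mcZ (fun w => c0 (Z w)) (fun w => c1 (Z w))).
by move=> B mB; rewrite !integral_preimage// cE//; exact: measurable_indic.
Qed.

(** [cond_exp] is an arbitrary choice among versions. That choice and [c] have equal integrals over
    every measurable set for the law of [Z], hence agree almost everywhere for this law; the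
    exceptional set is pulled back through [Z]. *)
Let cond_exp_ae : {ae P, forall w, cond_exp P Z Y w = c (Z w)}.
Proof.
rewrite /cond_exp; set h := xget _ _.
have [mh ih hE] : is_cond_exp P Z Y h by apply: xgetPex; exists c.
have ic := integrable01 mcZ (fun w => c0 (Z w)) (fun w => c1 (Z w)).
have [mce mhe] : measurable_fun setT (EFin \o c) /\ measurable_fun setT (EFin \o h).
  by split; apply/measurable_EFinP.
have intE (k : T' -> R) B : measurable_fun setT (EFin \o k) -> measurable B ->
    P.-integrable setT (EFin \o (k \o Z)) ->
    (\int[pushforward P Z]_(z in B) (k z)%:E = \int[P]_(w in Z @^-1` B) (k (Z w))%:E)%E.
  move=> mk mB ik; apply: (integral_pushforward mZ mk) => //.
  by apply: integrableS ik => //; rewrite -[X in measurable X]setTI; exact: mZ.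
have [_ _ cE'] := cond_exp_c.
have [nu nuE] := pushforward_measure_exists P mZ.
have pZ : pushforward P Z = nu by apply/funext => B; rewrite nuE.
have [N [mN PN hN]] : ae_eq nu setT (EFin \o c) (EFin \o h).
  apply: integral_ae_eq => //.
  - by rewrite -pZ; exact: (integrable_pushforward mZ mce).
  - by move=> B _ mB; rewrite -pZ !intE// hE// cE'.
exists (Z @^-1` N); split.
- by rewrite -[X in measurable X]setTI; exact: mZ.
- by rewrite -nuE.
- by move=> w /= hw; apply: hN => /= ch; apply: hw; case: (ch I).
Qed.

Let W w : R := (Y w - cond_exp P Z Y w) ^+ 2.

Let mcond_exp : measurable_fun setT (cond_exp P Z Y).
Proof.
rewrite /cond_exp; set h := xget _ _.
have [mh _ _] : is_cond_exp P Z Y h by apply: xgetPex; exists c.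
exact: measurableT_comp.
Qed.

Let mW : measurable_fun setT W.
Proof. by apply: measurable_funX; exact: measurable_funB. Qed.

Let I (B : set T') : \bar R := (\int[P]_w (\1_B (Z w) * (c (Z w) ^+ 2))%:E)%E.

Let I_fin B : measurable B -> I B \is a fin_num.
Proof.
move=> mB; apply: integrable_fin_num => //.
apply: (@integrable01 (fun w => \1_B (Z w) * (c (Z w) ^+ 2))) => [|w|w].
- apply: measurable_funM; last exact: measurable_funX.
  by apply: (measurableT_comp _ mZ); exact: measurable_indic.
- by rewrite mulr_ge0 ?sqr_ge0.
- have := c0 (Z w); have := c1 (Z w); rewrite indicE; case: (_ \in _) => /=; nra.
Qed.

(** Written as a sum so that only nonnegative functions are integrated. The cross term of the square
    reduces to [I B] by [cE] with [Phi = \1_B c], and the finite [I B] is cancelled last. *)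
Let integralW B : measurable B ->
  (\int[P]_(w in Z @^-1` B) (W w)%:E + I B = \int[P]_w (\1_B (Z w) * Y w)%:E)%E.
Proof.
move=> mB; rewrite integral_preimage//.
have m1Z : measurable_fun setT (fun w => \1_B (Z w) : R).
  by apply: (measurableT_comp _ mZ); exact: measurable_indic.
have mc2 : measurable_fun setT (fun w => c (Z w) ^+ 2) by exact: measurable_funX.
pose W0 w : R := (Y w - c (Z w)) ^+ 2.
have W00 w : 0 <= W0 w by exact: sqr_ge0.
have mW0 : measurable_fun setT W0 by apply: measurable_funX; exact: measurable_funB.
have -> : (\int[P]_w (\1_B (Z w) * W w)%:E = \int[P]_w (\1_B (Z w) * W0 w)%:E)%E.
  apply: ge0_ae_eq_integral => //.
  - by apply/measurable_EFinP; exact: measurable_funM.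
  - by apply/measurable_EFinP; exact: measurable_funM.
  - by move=> w _; rewrite lee_fin mulr_ge0 ?sqr_ge0.
  - by move=> w _; rewrite lee_fin mulr_ge0 ?sqr_ge0.
  - by have := cond_exp_ae; apply: filterS => w E _; rewrite /W E.
have I_E : (\int[P]_w (\1_B (Z w) * c (Z w) * Y w)%:E = I B)%E.
  rewrite -(cE (Phi := fun z => \1_B z * c z)).
  - by apply: eq_integral => w _; rewrite expr2 mulrA.
  - by apply: measurable_funM => //; exact: measurable_indic.
  - by move=> z; rewrite mulr_ge0.
have mY1 : measurable_fun setT (fun w => (\1_B (Z w) * Y w)%:E).
  by apply/measurable_EFinP; exact: measurable_funM.
have mI : measurable_fun setT (fun w => (\1_B (Z w) * c (Z w) ^+ 2)%:E).
  by apply/measurable_EFinP; exact: measurable_funM.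
have mIY : measurable_fun setT (fun w => (\1_B (Z w) * c (Z w) * Y w)%:E).
  by apply/measurable_EFinP; apply: measurable_funM => //; exact: measurable_funM.
have mW01 : measurable_fun setT (fun w => (\1_B (Z w) * W0 w)%:E).
  by apply/measurable_EFinP; exact: measurable_funM.
(* [1_B (Y - c)^2 + 2 1_B c Y = 1_B Y + 1_B c^2] since [Y^2 = Y] *)
have sumE : (\int[P]_w (\1_B (Z w) * W0 w)%:E + I B + I B =
    \int[P]_w (\1_B (Z w) * Y w)%:E + I B)%E.
  rewrite -{1 2}I_E /I -!ge0_integralD//.
  - apply: eq_integral => w _; rewrite -!EFinD; congr EFin; rewrite /W0.
    by have := Y2 w; rewrite sqrrB => ->; ring.
  - by move=> w _; rewrite lee_fin mulr_ge0.
  - by move=> w _; rewrite lee_fin mulr_ge0 ?sqr_ge0.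
  - move=> w _; rewrite -EFinD lee_fin; apply: addr_ge0; first exact: mulr_ge0.
    by apply: mulr_ge0 => //; exact: mulr_ge0.
  - exact: emeasurable_funD.
  - by move=> w _; rewrite lee_fin ?mulr_ge0 ?mulr_ge0.
  - by move=> w _; rewrite lee_fin mulr_ge0 ?sqr_ge0.
  - by move=> w _; rewrite lee_fin ?mulr_ge0 ?mulr_ge0.
by rewrite -[LHS](addeK _ (I_fin mB)) sumE addeK//; exact: I_fin.
Qed.

(** [c - c^2] is the variance of a Bernoulli variable of parameter [c]; adding [I B] to both sides
    reduces the claim to [integralW] and [cE]. *)
Let cond_exp_W : is_cond_exp P Z W (fun z => c z - c z ^+ 2).
Proof.
have m1 : measurable_fun setT (fun z => c z - c z ^+ 2).
  by apply: measurable_funB => //; exact: measurable_funX.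
have v0 z : 0 <= c z - c z ^+ 2 by have := c0 z; have := c1 z; nra.
have v1 z : c z - c z ^+ 2 <= 1 by have := c0 z; have := c1 z; nra.
have m1Z : measurable_fun setT (fun w => c (Z w) - c (Z w) ^+ 2).
  exact: measurableT_comp m1 mZ.
split=> //; first exact: (integrable01 m1Z (fun w => v0 (Z w)) (fun w => v1 (Z w))).
move=> B mB; rewrite -[LHS](addeK _ (I_fin mB)) -[RHS](addeK _ (I_fin mB)).
congr (_ - _)%E.
rewrite integralW// -(cE (Phi := \1_B))//.
have mB1 : measurable_fun setT (fun w => \1_B (Z w) : R).
  by apply: (measurableT_comp _ mZ); exact: measurable_indic.
rewrite integral_preimage// /I -ge0_integralD//.
- by apply: eq_integral => w _; rewrite -EFinD; congr EFin; ring.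
- by move=> w _; rewrite lee_fin mulr_ge0.
- by apply/measurable_EFinP; exact: measurable_funM.
- by move=> w _; rewrite lee_fin mulr_ge0 ?sqr_ge0.
- by apply/measurable_EFinP; apply: measurable_funM => //; exact: measurable_funX.
Qed.

(** This is [integralW] on the whole space, since every version of a conditional expectation has the
    same total integral as the variable. *)
Lemma expectation_cond_var :
  ('E_P[cond_var P Z Y] + \int[P]_w (c (Z w) ^+ 2)%:E = \int[P]_w (Y w)%:E)%E.
Proof.
have -> : (\int[P]_w (c (Z w) ^+ 2)%:E = I setT)%E.
  by apply: eq_integral => w _; rewrite indicT mul1r.
have -> : (\int[P]_w (Y w)%:E = \int[P]_w (\1_setT (Z w) * Y w)%:E)%E.
  by apply: eq_integral => w _; rewrite indicT mul1r.
rewrite -integralW//; congr (_ + _)%E.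
rewrite unlock /cond_var -/W /=.
set h := xget (cst 0) [set h | is_cond_exp P Z W h].
have [_ _ hE] : is_cond_exp P Z W h by apply: xgetPex; exists (fun z => c z - c z ^+ 2).
by have := hE setT measurableT; rewrite preimage_setT.
Qed.

End conditional_variance.

(** * Products of two weights *)

Section pair_expectation.
Context {R : realType} {d : nat} (u : {set 'I_d}).
Variables (f g : d.-tuple R -> R) (A : set (d.-tuple R)).
Hypotheses (mf : measurable_fun setT f) (f0 : forall x, 0 <= f x).
Hypothesis f1 : (\int[lebesgue_tuple d]_x (f x)%:E = 1)%E.
Hypotheses (mg : measurable_fun setT g) (g0 : forall x, 0 <= g x).
Hypothesis g1 : (\int[lebesgue_tuple d]_x (g x)%:E = 1)%E.
Hypothesis mA : measurable A.
Hypothesis g_gt0 : forall x, 0 < \1_A x * f x -> 0 < g x.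

Local Notation a := (fun x => \1_A x * f x).
Local Notation wt := (fun x => \1_A x * f x / g x).
Local Notation q := (cond_density u g).
Local Notation G := (marginalC u g).
Local Notation F := (marginalC u f).
Local Notation T2 := (#|u|.-tuple R * #|~: u|.-tuple R)%type.
Local Notation T3 := ((#|~: u|.-tuple R * #|u|.-tuple R) * #|u|.-tuple R)%type.
Local Notation LX := (lebesgue_tuple #|u|).
Local Notation LY := (lebesgue_tuple #|~: u|).

Let ma : measurable_fun setT a.
Proof. by apply: measurable_funM => //; exact: measurable_indic. Qed.

Let a0 x : 0 <= a x.
Proof. by rewrite mulr_ge0. Qed.

Let mG : measurable_fun setT G.
Proof. exact: measurable_marginalC. Qed.

Let mVG : measurable_fun setT (fun y => (G y)^-1).
Proof. by apply: measurableT_comp mG; exact: measurable_inv. Qed.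

Let G0 y : 0 <= G y.
Proof. exact: marginalC_ge0. Qed.

Lemma measurable_weight : measurable_fun setT wt.
Proof.
apply: measurable_funM => //.
by apply: measurableT_comp mg; exact: measurable_inv.
Qed.

Lemma weight_ge0 x : 0 <= wt x.
Proof. by rewrite divr_ge0// a0. Qed.

(** Where [g] is 0 the product is 0, and [a] cannot be positive there by [g_gt0]. *)
Lemma weightM x : wt x * g x = a x.
Proof.
have [gx0|gx0] := eqVneq (g x) 0; last by rewrite divfK.
rewrite gx0 mulr0; apply/esym/eqP; rewrite eq_le a0 andbT leNgt.
by apply/negP => /g_gt0; rewrite gx0 ltxx.
Qed.

Lemma cond_density_ge0 y x : 0 <= q y x.
Proof. by rewrite divr_ge0. Qed.

Lemma measurable_cond_density d' (T : measurableType d') (yy : T -> #|~: u|.-tuple R)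
    (xx : T -> #|u|.-tuple R) : measurable_fun setT yy -> measurable_fun setT xx ->
  measurable_fun setT (fun z => q (yy z) (xx z)).
Proof.
move=> myy mxx; apply: measurable_funM.
  by apply: (measurableT_comp mg); exact: measurable_glue.
exact: (measurableT_comp mVG).
Qed.

(** Conditional law of each [Z k] given [Y = y]; it has mass 1 when [G y != 0] and is the zero
    measure when [G y = 0], since division by 0 gives 0. *)
Let K (y : #|~: u|.-tuple R) (B : set (#|u|.-tuple R)) : \bar R :=
  (\int[LX]_(x in B) (q y x)%:E)%E.

Let K_ge0 y B : (0 <= K y B)%E.
Proof. by apply: integral_ge0 => x _; rewrite lee_fin cond_density_ge0. Qed.

Let mK B : measurable B -> measurable_fun setT (K ^~ B).
Proof.
move=> mB.
pose k := ((fun p : T2 => (q p.2 p.1)%:E) \_ (B `*` setT))%E.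
have -> : K ^~ B = fubini_G LX k.
  apply/funext => y; rewrite /K integral_mkcond; apply: eq_integral => z _.
  by rewrite /k !patchE in_setX in_setT andbT.
apply: measurable_fun_fubini_tonelli_G.
  have mq : measurable_fun setT (fun p : T2 => (q p.2 p.1)%:E).
    by apply/measurable_EFinP; exact: measurable_cond_density.
  exact: ((measurable_restrictT _ (measurableX mB measurableT)).1 (measurable_funTS mq)).
by move=> z; rewrite /k patchE; case: ifP => // _; rewrite lee_fin cond_density_ge0.
Qed.

Let KT y : G y != 0 -> K y setT = 1%E.
Proof.
move=> Gy; rewrite /K /cond_density.
under eq_integral do rewrite EFinM.
rewrite ge0_integralZr//.
- rewrite -/(emarginal u g y) -[emarginal u g y]fineK -?marginalCE.
    by rewrite -EFinM divff.
  move: Gy; rewrite marginalCE; case: (emarginal u g y) => //=; rewrite eqxx//.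
- apply/measurable_EFinP; apply: (measurableT_comp mg); exact: measurable_glue.
- by move=> x _; rewrite lee_fin.
- by rewrite lee_fin invr_ge0.
Qed.

Context {dO} {O : measurableType dO} (P : probability O R) {N : nat}.
Variables (Y : {RV P >-> #|~: u|.-tuple R}) (Z : 'I_N -> {RV P >-> #|u|.-tuple R}).
Hypothesis Y_density : has_density P Y G.
Hypothesis Z_iid : cond_iid_density P Y (fun k => Z k) q.

(** Density of the triple [(Y, Z k, Z l)] for [k != l], as [law_pair] shows. *)
Let h (p : T3) : R :=
  G p.1.1 * q p.1.1 p.1.2 * q p.1.1 p.2.

Let mh : measurable_fun setT h.
Proof.
have m1 : measurable_fun setT (fun p : T3 => p.1.1).
  exact: measurableT_comp.
have m2 : measurable_fun setT (fun p : T3 => p.1.2).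
  exact: measurableT_comp.
apply: measurable_funM; last exact: measurable_cond_density.
by apply: measurable_funM; [exact: measurableT_comp mG m1|exact: measurable_cond_density].
Qed.

Let h0 p : 0 <= h p.
Proof. by apply: mulr_ge0; [apply: mulr_ge0 => //|]; exact: cond_density_ge0. Qed.

(** The indices other than [k] and [l] contribute total mass 1. Where [G y = 0] the kernel is null,
    but the factor [G y] annihilates both sides. *)
Let prodK k l y B C : k != l ->
  (\prod_(j < N) K y (if j == k then B else if j == l then C else setT) * (G y)%:E =
   (G y)%:E * K y B * K y C)%E.
Proof.
move=> kl; have [->|Gy] := eqVneq (G y) 0; first by rewrite mule0 !mul0e.
rewrite (bigD1 k)//= eqxx (bigD1 l)/=; last by rewrite eq_sym.
rewrite eqxx ifN 1?eq_sym// big1 ?mule1; last first.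
  by move=> j /andP[/negbTE -> /negbTE ->]; exact: KT.
by rewrite muleC muleA.
Qed.

(** The conditional product formula is used with the full space at all indices but [k] and [l]; the
    outer expectation is then an integral against the density [G] of [Y]. *)
Lemma law_pair k l : k != l ->
  forall B C E, measurable B -> measurable C -> measurable E ->
  P (Y @^-1` B `&` Z k @^-1` C `&` Z l @^-1` E) =
  (\int[LY]_(y in B) \int[LX]_(x in C) \int[LX]_(x' in E) (h (y, x, x'))%:E)%E.
Proof.
move=> kl B C E mB mC mE.
pose Q j := if j == k then C else if j == l then E else setT.
have mQ j : measurable (Q j) by rewrite /Q; case: ifP => // _; case: ifP.
transitivity (P (Y @^-1` B `&` [set w | forall j, Q j (Z j w)])).
  congr (P _); apply/seteqP; split=> w /=.
    move=> [[? ?] ?]; split=> // j; rewrite /Q.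
    by case: eqP => [->//|_]; case: eqP => [->//|_].
  move=> [? hQ]; split; [split=> //|].
    by have := hQ k; rewrite /Q eqxx.
  by have := hQ l; rewrite /Q eqxx ifN 1?eq_sym.
rewrite Z_iid// integral_mkcond.
pose Pi y := (\prod_(j < N) K y (Q j))%E.
have mPi : measurable_fun setT Pi.
  rewrite /Pi; elim: (index_enum _) => [|j s IH].
    by under eq_fun do rewrite big_nil; exact: measurable_cst.
  by under eq_fun do rewrite big_cons; apply: emeasurable_funM => //; exact: mK.
have Pi0 y : (0 <= Pi y)%E by apply: prode_ge0 => j _; exact: K_ge0.
transitivity (\int[P]_w (Pi \_ B) (Y w))%E.
  apply: eq_integral => w _; rewrite !patchE.
  by have -> : (w \in Y @^-1` B) = (Y w \in B) by apply/idP/idP; rewrite !inE.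
have mPiB : measurable_fun setT (Pi \_ B)%E.
  exact: ((measurable_restrictT _ mB).1 (measurable_funTS mPi)).
have mGE : measurable_fun setT (EFin \o G) by exact/measurable_EFinP.
rewrite (ge0_integral_law (m := P) (V := Y) _ mGE _ _ Y_density mPiB)//; last first.
  by move=> y; rewrite patchE; case: ifP.
rewrite [RHS]integral_mkcond; apply: eq_integral => y _; rewrite !patchE.
case: ifP => _; last by rewrite mul0e.
rewrite /Pi /= prodK// /K.
have mq : measurable_fun setT (fun x => (q y x)%:E).
  by apply/measurable_EFinP; exact: measurable_cond_density.
have q0 x : (0 <= (q y x)%:E)%E by rewrite lee_fin cond_density_ge0.
have -> : (\int[LX]_(x in C) \int[LX]_(x' in E) (h (y, x, x'))%:E =
    \int[LX]_(x in C) (((G y)%:E * K y E) * (q y x)%:E))%E.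
  apply: eq_integral => x _; rewrite /K muleAC -ge0_integralZl//.
  - exact: measurable_funTS.
  - by rewrite mule_ge0 ?lee_fin ?cond_density_ge0.
rewrite ge0_integralZl//; first by rewrite muleAC.
- exact: measurable_funTS.
- by rewrite mule_ge0 ?lee_fin ?K_ge0.
Qed.

(** Against the joint density, [G / F] and the three factors of [h] turn the two weights into
    [a a' / F]; the inner integrals then give the squared marginal of [a] over [F], which is the
    squared conditional probability times [F]. *)
Lemma pair_expectation k l : k != l ->
  (\int[P]_w (wt (Defs.glue (Z k w) (Y w)) * wt (Defs.glue (Z l w) (Y w)) *
              (G (Y w) / F (Y w)))%:E =
   \int[LY]_y ((cond_prob u f A y ^+ 2)%:E * emarginal u f y))%E.
Proof.
move=> kl.
have mwt := measurable_weight.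
have mF : measurable_fun setT F by exact: measurable_marginalC.
have mVF : measurable_fun setT (fun y => (F y)^-1).
  by apply: measurableT_comp mF; exact: measurable_inv.
have F0 y : 0 <= F y by exact: marginalC_ge0.
pose H (p : T3) : R :=
  wt (Defs.glue p.1.2 p.1.1) * wt (Defs.glue p.2 p.1.1) * (G p.1.1 / F p.1.1).
have m1 : measurable_fun setT (fun p : T3 => p.1.1).
  exact: measurableT_comp.
have m2 : measurable_fun setT (fun p : T3 => p.1.2).
  exact: measurableT_comp.
have mH : measurable_fun setT H.
  apply: measurable_funM; [apply: measurable_funM|apply: measurable_funM].
  - by apply: (measurableT_comp mwt); exact: measurable_glue.
  - by apply: (measurableT_comp mwt); exact: measurable_glue.
  - exact: (measurableT_comp mG).
  - exact: (measurableT_comp mVF).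
have H0 p : 0 <= H p.
  by apply: mulr_ge0; [apply: mulr_ge0; exact: weight_ge0|exact: divr_ge0].
transitivity (\int[LY]_y \int[LX]_x \int[LX]_x'
    ((H (y, x, x'))%:E * (h (y, x, x'))%:E))%E.
  apply: (ge0_integral_law3 (m := P) (V1 := Y) (V2 := Z k) (V3 := Z l)
    (h := EFin \o h) (F := EFin \o H)) => //.
  - exact: (le_lt_trans (probability_le1 P measurableT) (ltry _)).
  - exact/measurable_EFinP.
  - exact: law_pair.
  - exact/measurable_EFinP.
have ea0 y : (0 <= emarginal u a y)%E by exact: emarginal_ge0.
have mglue (b : d.-tuple R -> R) y : measurable_fun setT b ->
    measurable_fun setT (fun x => (b (Defs.glue x y))%:E).
  move=> mb; apply/measurable_EFinP; apply: (measurableT_comp mb).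
  exact: measurable_glue.
(* [G y / G y] is the indicator of [G y != 0]; keeping it makes the pointwise identity exact at the
   zeros of [G]. *)
transitivity (\int[LY]_y (((F y)^-1 * (G y / G y))%:E *
    emarginal u a y * emarginal u a y))%E.
  apply: eq_integral => y _.
  have HhE x x' : ((H (y, x, x'))%:E * (h (y, x, x'))%:E =
      ((F y)^-1 * (G y / G y))%:E * (a (Defs.glue x y))%:E * (a (Defs.glue x' y))%:E)%E.
    rewrite -!EFinM; congr EFin; rewrite /H /h /cond_density.
    transitivity ((F y)^-1 * (G y / G y) * (wt (Defs.glue x y) * g (Defs.glue x y)) *
        (wt (Defs.glue x' y) * g (Defs.glue x' y))); last by rewrite !weightM.
    move: (wt _) (wt _) => w1 w2 /=.
    have [->|Gy] := eqVneq (G y) 0; first by rewrite !(mul0r, mulr0).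
    move: (F y)^-1 => iF.
    by field.
  under eq_integral => x _ do under eq_integral => x' _ do rewrite HhE.
  have c0 : 0 <= (F y)^-1 * (G y / G y) by rewrite mulr_ge0 ?divr_ge0 ?invr_ge0.
  under eq_integral => x _.
    rewrite ge0_integralZl//; last first.
    - by rewrite -EFinM lee_fin mulr_ge0// a0.
    - by move=> x' _; rewrite lee_fin a0.
    - exact: mglue ma.
    rewrite muleAC; over.
  rewrite ge0_integralZl//.
  - exact: mglue ma.
  - by move=> x _; rewrite lee_fin a0.
  - by apply: mule_ge0; [rewrite lee_fin|exact: ea0].
apply: ge0_ae_eq_integral => //.
- apply: emeasurable_funM; last exact: measurable_emarginal.
  apply: emeasurable_funM; last exact: measurable_emarginal.
  by apply/measurable_EFinP; apply: measurable_funM => //; exact: measurable_funM.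
- apply: emeasurable_funM; last exact: measurable_emarginal.
  by apply/measurable_EFinP; apply: measurable_funX; exact: measurable_cond_prob.
- by move=> y _; rewrite !mule_ge0// lee_fin mulr_ge0 ?divr_ge0 ?invr_ge0.
- by move=> y _; rewrite mule_ge0 ?emarginal_ge0// lee_fin sqr_ge0.
have cae := cond_probM_ae u mf f0 f1 mA.
have gae := emarginal_fin_num_ae u mg g0.
have fae := emarginal_fin_num_ae u mf f0.
rewrite g1 ltry in gae; rewrite f1 ltry in fae.
have := gae isT; have := fae isT; move: cae; apply: filterS3 => y cy fy gy _.
(* Only one of the two factors [cond_prob] is absorbed into the marginal of [f]; the other supplies
   [1 / F], so [F y = 0] needs no case. *)
rewrite expr2 (EFinM (cond_prob u f A y)) -[RHS]muleA cy.
have eaE : emarginal u a y = (marginalC u a y)%:E.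
  rewrite marginalCE fineK// -cy fin_numM//.
rewrite eaE -!EFinM; congr EFin; rewrite /cond_prob.
(* Where [G y = 0] the left side is 0; the right side is too, since positivity of [g] wherever
   [a > 0] makes the marginal of [a] vanish. *)
have [Gy|Gy] := eqVneq (G y) 0; last by rewrite divff//; ring.
have g_y : emarginal u g y = 0%E by rewrite -[LHS]fineK// -marginalCE Gy.
have := emarginal_eq0 ma mg a0 g0 g_gt0 g_y.
by rewrite eaE => -[->]; rewrite !mulr0.
Qed.

End pair_expectation.

(** * The estimator and its programs *)

Section unbiased_estimators.
Context {R : realType} {d} {T : measurableType d} (P : probability T R).

Lemma expectationE (E : T -> R) : ('E_P[E] = \int[P]_w (E w)%:E)%E.
Proof. by rewrite unlock. Qed.

(** The integral is a real number, so integrability comes with its computation and needs no separate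
    bound. *)
Lemma ge0_unbiased (E : T -> R) (a : R) : measurable_fun setT E ->
  (forall w, 0 <= E w) -> (\int[P]_w (E w)%:E = a%:E)%E -> unbiased P E a%:E.
Proof.
move=> mE E0 Ea; split; last by rewrite expectationE.
apply/integrableP; split; first exact/measurable_EFinP.
by under eq_integral => w _ do rewrite /= ger0_norm//; rewrite Ea ltry.
Qed.

Lemma unbiasedB (E F : T -> R) (a b : R) : unbiased P E a%:E -> unbiased P F b%:E ->
  unbiased P (fun w => E w - F w) (a - b)%:E.
Proof.
rewrite /unbiased !expectationE => -[iE Ea] [iF Fb].
split; first exact: (integrableB measurableT iE iF).
by under eq_integral do rewrite EFinB; rewrite integralB_EFin// Ea Fb.
Qed.

Lemma unbiasedZ (k : R) (E : T -> R) (a : R) : unbiased P E a%:E ->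
  unbiased P (fun w => k * E w) (k * a)%:E.
Proof.
rewrite /unbiased !expectationE => -[iE Ea].
split; first exact: (@integrableZl _ _ _ P setT measurableT k (EFin \o E)).
by under eq_integral do rewrite EFinM; rewrite integralZl// Ea.
Qed.

Lemma unbiased_sum (J : finType) (Q : pred J) (E : J -> T -> R) (a : R) :
  (forall j, Q j -> unbiased P (E j) a%:E) ->
  unbiased P (fun w => \sum_(j | Q j) E j w) (a *+ #|Q|)%:E.
Proof.
(* Terms outside [Q] are replaced by 0 because they need not be integrable: in the sum over pairs,
   the excluded [l = k] carries a squared weight. *)
move=> Ea; pose E' j w : R := if Q j then E j w else 0.
have iE j : P.-integrable setT (EFin \o E' j).
  have [Qj|Qj] := boolP (Q j).
    by rewrite (_ : E' j = E j); [case: (Ea j Qj)|apply/funext => w; rewrite /E' Qj].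
  rewrite (_ : EFin \o E' j = cst 0%E); first exact: integrable0.
  by apply/funext => w; rewrite /E' /= (negbTE Qj).
have intE j : Q j -> (\int[P]_w (E' j w)%:E = a%:E)%E.
  by move=> Qj; rewrite -expectationE /E' Qj; case: (Ea j Qj).
have intE0 j : ~~ Q j -> (\int[P]_w (E' j w)%:E = 0)%E.
  by move=> Qj; rewrite /E' (negbTE Qj) integral0.
have sumE w : (\sum_(j | Q j) E j w)%:E = (\sum_j (E' j w)%:E)%E.
  by rewrite sumEFin big_mkcond.
rewrite /unbiased expectationE; split.
  rewrite (_ : EFin \o _ = (fun w => \sum_j (E' j w)%:E)%E); last exact/funext.
  by apply: integrable_sum => // j _; exact: iE.
under eq_integral => w _ do rewrite sumE.
rewrite integral_sum//.
rewrite (bigID Q)/= [X in (_ + X)%E]big1 ?adde0//.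
by rewrite (eq_bigr (fun=> a%:E)) // sumEFin sumr_const.
Qed.

Lemma unbiased_mean n (E : 'I_n -> T -> R) (a : R) : (0 < n)%N ->
  (forall j, unbiased P (E j) a%:E) ->
  unbiased P (fun w => mean (fun j => E j w)) a%:E.
Proof.
move=> n0 Ea; have := unbiasedZ (n%:R^-1) (unbiased_sum (Q := predT) (fun j _ => Ea j)).
by rewrite card_ord -[a *+ n]mulr_natl mulKf// pnatr_eq0 -lt0n.
Qed.

End unbiased_estimators.

(** * The debiased square as a sum over pairs *)

Section weights_algebra.
Context {R : realType}.

Lemma mean_sub n (a b : 'I_n -> R) : mean a - mean b = mean (fun i => a i - b i).
Proof. by rewrite /mean sumrB mulrBr. Qed.

(** The off-diagonal sum is the square of the sum minus the sum of squares, and [n (n - 1)] counts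
    the ordered pairs: the debiased square is a U-statistic, free of any [W k ^+ 2]. *)
Lemma sqr_mean_debiased n (W : 'I_n -> R) : (1 < n)%N ->
  mean W ^+ 2 - (n%:R - 1)^-1 * (mean (fun k => W k ^+ 2) - mean W ^+ 2) =
  (n%:R * (n%:R - 1))^-1 * \sum_k \sum_(l | l != k) W k * W l.
Proof.
move=> n1.
have nn0 : (n%:R : R) != 0 by rewrite pnatr_eq0 -lt0n ltnW.
have nn1 : (n%:R - 1 : R) != 0 by rewrite subr_eq0 -[1]/(1%:R) eqr_nat gtn_eqF.
have -> : \sum_k \sum_(l | l != k) W k * W l = (\sum_k W k) ^+ 2 - \sum_k W k ^+ 2.
  rewrite expr2 mulr_suml -sumrB; apply: eq_bigr => k _.
  by rewrite mulr_sumr [X in _ = X - _](bigD1 k)//= expr2 addrAC subrr add0r.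
by rewrite /mean; field; rewrite nn0 nn1.
Qed.

Lemma TEV_of_weightsE Nu NI (p : R) (W : 'I_Nu -> 'I_NI -> R) (rho : 'I_Nu -> R) :
  (1 < NI)%N ->
  TEV_of_weights p W rho = p - mean (fun n => (NI%:R * (NI%:R - 1))^-1 *
    \sum_k \sum_(l | l != k) W n k * W n l * rho n).
Proof.
move=> NI1; rewrite /TEV_of_weights /bias_of_weights mean_sub; congr (p - mean _).
apply/funext => n; rewrite -mulrBl sqr_mean_debiased// -mulrA; congr (_ * _).
by rewrite mulr_suml; apply: eq_bigr => k _; rewrite mulr_suml.
Qed.

End weights_algebra.

(** * Results and evaluation counts of the programs *)

Section oracle_programs.
Context {Q A : Type} (phi : Q -> A).

Lemma run_bind B C (p : oracle_prog Q A B) (r : B -> oracle_prog Q A C) :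
  run phi (Defs.bind p r) = run phi (r (run phi p)).
Proof. by elim: p => [b|q k IH] //=; rewrite IH. Qed.

Lemma nb_queries_bind B C (p : oracle_prog Q A B) (r : B -> oracle_prog Q A C) :
  nb_queries phi (Defs.bind p r) = (nb_queries phi p + nb_queries phi (r (run phi p)))%N.
Proof. by elim: p => [b|q k IH] //=; rewrite IH. Qed.

Lemma tnth_run_traverse B n (p : 'I_n -> oracle_prog Q A B) i :
  tnth (run phi (traverse p)) i = run phi (p i).
Proof.
elim: n p i => [|n IH] p i; first by case: i.
rewrite /= !run_bind /=; case: (unliftP ord0 i) => [j|] ->; last by rewrite tnth0.
by rewrite tnthS IH.
Qed.

Lemma nb_queries_traverse B n (p : 'I_n -> oracle_prog Q A B) :
  nb_queries phi (traverse p) = (\sum_i nb_queries phi (p i))%N.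
Proof.
elim: n p => [|n IH] p; first by rewrite big_ord0.
by rewrite /= !nb_queries_bind /= IH addn0 big_ord_recl.
Qed.

End oracle_programs.

Section estimation_programs.
Context {R : realType} {d : nat} (phi : d.-tuple R -> R) (t : R).
Variables (f g : d.-tuple R -> R) (u : {set 'I_d}).

Lemma run_p_prog N (x : 'I_N -> d.-tuple R) :
  run phi (p_prog t f g x) = p_IS phi t f g x.
Proof.
rewrite run_bind /=; congr mean; apply/funext => n.
by rewrite tnth_run_traverse.
Qed.

Lemma run_TEV_prog N Nu NI (x : 'I_N -> d.-tuple R)
    (y : 'I_Nu -> #|~: u|.-tuple R) (z : 'I_Nu -> 'I_NI -> #|u|.-tuple R) :
  run phi (TEV_prog t f g u x y z) = TEV_IS phi t f g u x y z.
Proof.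
rewrite run_bind run_p_prog run_bind /=; congr (TEV_of_weights _ _ _).
by apply/funext => n; apply/funext => k; rewrite !tnth_run_traverse.
Qed.

Lemma nb_queries_TEV_prog N Nu NI (x : 'I_N -> d.-tuple R)
    (y : 'I_Nu -> #|~: u|.-tuple R) (z : 'I_Nu -> 'I_NI -> #|u|.-tuple R) :
  nb_queries phi (TEV_prog t f g u x y z) =
    (nb_queries phi (p_prog t f g x) + Nu * NI)%N.
Proof.
rewrite nb_queries_bind nb_queries_bind nb_queries_traverse /= addn0; congr addn.
rewrite mulnC -iter_addn_0 -big_const_ord; apply: eq_bigr => n _.
by rewrite nb_queries_traverse /= big_const_ord iter_addn_0 mul1n.
Qed.

End estimation_programs.

Unset Implicit Arguments.
Set Strict Implicit.
Set Printing Implicit Defensive.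


Theorem proposition1 (R : realType) (d : nat) (D : 'I_d -> set R)
  (mD : forall i, measurable (D i))
  (f : d.-tuple R -> R) (f_density : is_density (prod_set D) f)
  (phi : d.-tuple R -> R) (mphi : measurable_fun (prod_set D) phi) (t : R)
  (* the random vector X with joint density f *)
  (dO0 : measure_display) (O0 : measurableType dO0) (P0 : probability O0 R)
  (X : {RV P0 >-> d.-tuple R}) (X_in_D : forall w, prod_set D (X w))
  (X_density : has_density P0 X f)
  (u : {set 'I_d}) (u_neq0 : u != finset.set0) (u_neqT : u != [set: 'I_d]%SET)
  (g : d.-tuple R -> R) (g_density : is_density (prod_set D) g)
  (g_gt0 : forall x, 0 < psi phi t x * f x -> 0 < g x)
  (N Nu NI : nat) (hN : (1 <= N)%N) (hNu : (1 <= Nu)%N) (hNI : (2 <= NI)%N)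
  (* the samples drawn from g *)
  (dO : measure_display) (O : measurableType dO) (P : probability O R)
  (Xs : 'I_N -> {RV P >-> d.-tuple R})
  (Xs_iid : iid_density P (fun n => Xs n) g)
  (Ys : 'I_Nu -> {RV P >-> #|~: u|.-tuple R})
  (Ys_iid : iid_density P (fun n => Ys n) (marginalC u g))
  (Zs : 'I_Nu -> 'I_NI -> {RV P >-> #|u|.-tuple R})
  (Zs_iid : forall n,
    cond_iid_density P (Ys n) (fun k => Zs n k) (cond_density u g)) :
  unbiased P
    (fun w => TEV_IS phi t f g u
       (fun n => Xs n w) (fun n => Ys n w) (fun n k => Zs n k w))
    (TEV P0 X phi t u)
  /\
  forall (x : 'I_N -> d.-tuple R) (y : 'I_Nu -> #|~: u|.-tuple R)
    (z : 'I_Nu -> 'I_NI -> #|u|.-tuple R),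
  [/\ run phi (p_prog t f g x) = p_IS phi t f g x,
      run phi (TEV_prog t f g u x y z) = TEV_IS phi t f g u x y z &
      nb_queries phi (TEV_prog t f g u x y z) =
        (nb_queries phi (p_prog t f g x) + Nu * NI)%N].
Proof.
split; last first.
  by move=> x y z; split; [exact: run_p_prog|exact: run_TEV_prog|exact: nb_queries_TEV_prog].
have [mf f0 fD f1] := f_density; have [mg g0 _ g1] := g_density.
have mPD : measurable (prod_set D) by exact: measurable_box.
(* [phi] is measurable on the domain only, so the event is intersected with it. Since [f] vanishes
   outside, multiplying by [f] makes [psi] and [\1_A] agree everywhere. *)
pose A := prod_set D `&` phi @^-1` `]t, +oo[.
have mA : measurable A by apply: mphi => //; exact: measurable_itv.
have psiA x : prod_set D x -> psi phi t x = \1_A x.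
  move=> Dx; rewrite /psi indicE; congr (_%:R); congr nat_of_bool; apply/idP/idP.
    by move=> tx; rewrite inE; split=> //=; rewrite in_itv/= tx.
  by rewrite inE => -[_] /=; rewrite in_itv/= andbT.
have psifA x : psi phi t x * f x = \1_A x * f x.
  by have [/psiA ->//|/fD ->] := pselect (prod_set D x); rewrite !mulr0.
have g_gt0A x : 0 < \1_A x * f x -> 0 < g x by rewrite -psifA; exact: g_gt0.
have wtE x : weight phi t f g x = \1_A x * f x / g x by rewrite /weight psifA.
have ma : measurable_fun setT (fun x => \1_A x * f x).
  by apply: measurable_funM => //; exact: measurable_indic.
have a0 x : 0 <= \1_A x * f x by rewrite mulr_ge0.
have mwt := measurable_weight mf mg mA.
have wt0 x : 0 <= \1_A x * f x / g x by exact: weight_ge0.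
have mX : measurable_fun setT X by [].
pose Y w : R := \1_A (X w).
pose Z := subvec (~: u) \o X.
have mZ : measurable_fun setT Z by apply: (measurableT_comp _ mX); exact: measurable_subvec.
have mY : measurable_fun setT Y by apply: (measurableT_comp _ mX); exact: measurable_indic.
have mcp : measurable_fun setT (cond_prob u f A) by exact: measurable_cond_prob.
have cp0 y : 0 <= cond_prob u f A y by exact: cond_prob_ge0.
have cp1 y : cond_prob u f A y <= 1 by exact: cond_prob_le1.
have integral_le1 (k : O0 -> R) : measurable_fun setT k -> (forall w, 0 <= k w) ->
    (forall w, k w <= 1) -> (\int[P0]_w (k w)%:E)%E \is a fin_num.
  move=> mk k0 k1; apply: integrable_fin_num => //.
  apply: (@le_integrable _ _ _ _ _ _ _ (cst 1%E)) => //.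
  - exact/measurable_EFinP.
  - by move=> w _ /=; rewrite lee_fin normr1 ger0_norm.
  - exact: finite_measure_integrable_cst.
(* [p] and, below, [c] are taken in [R], both integrals being at most 1, so that they can be
   subtracted. *)
pose p := fine (\int[P0]_w (Y w)%:E)%E.
have pE : (\int[P0]_w (Y w)%:E)%E = p%:E.
  by rewrite fineK//; apply: integral_le1 => // w; rewrite /Y indicE; case: (_ \in _).
pose c := fine (\int[P0]_w (cond_prob u f A (Z w) ^+ 2)%:E)%E.
have cE : (\int[P0]_w (cond_prob u f A (Z w) ^+ 2)%:E)%E = c%:E.
  rewrite fineK//; apply: integral_le1 => [|w|w].
  - by apply: measurable_funX; exact: (measurableT_comp mcp mZ).
  - exact: sqr_ge0.
  - by rewrite expr_le1.
have TEVE : TEV P0 X phi t u = (p - c)%:E.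
  have YE : psi phi t \o X = Y by apply/funext => w; exact: psiA.
  rewrite /TEV YE -/Z.
  have Y2 w : Y w ^+ 2 = Y w by rewrite /Y indicE; case: (_ \in _); rewrite ?expr1n ?expr0n.
  have := expectation_cond_var mZ mY mcp Y2 cp0 cp1
    (cond_prob_cond_exp mf f0 f1 mA X_density).
  by rewrite cE pE => E; rewrite EFinB -E addeK.
have pYs : (\int[lebesgue_tuple d]_x (\1_A x * f x)%:E)%E = p%:E.
  rewrite -pE; apply/esym.
  rewrite (ge0_integral_law (m := P0) (V := X) (h := EFin \o f)
    (F := fun x => (\1_A x)%:E) _ _ _ _ X_density)//.
  - exact/measurable_EFinP.
  - by apply/measurable_EFinP; exact: measurable_indic.
have cYs : (\int[lebesgue_tuple #|~: u|]_y
    ((cond_prob u f A y ^+ 2)%:E * emarginal u f y))%E = c%:E.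
  rewrite -cE.
  have mcp2 : measurable_fun setT (fun y => cond_prob u f A y ^+ 2) by exact: measurable_funX.
  have H := ge0_integral_subvec mf f0 X_density mcp2
    (fun y => sqr_ge0 _) (measurable_cst (1 : R)) (fun=> ler01).
  apply/esym; apply: etrans (etrans _ H) _; first by apply: eq_integral => w _; rewrite /= mulr1.
  apply: eq_integral => y _; congr (_ * _)%E.
  by apply: eq_integral => x _; rewrite /= mul1r.
rewrite TEVE.
have -> : (fun w => TEV_IS phi t f g u (fun n => Xs n w) (fun n => Ys n w)
      (fun n k => Zs n k w)) =
    (fun w => mean (fun n => weight phi t f g (Xs n w)) -
      mean (fun n => (NI%:R * (NI%:R - 1))^-1 * \sum_k \sum_(l | l != k)
        weight phi t f g (Defs.glue (Zs n k w) (Ys n w)) *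
        weight phi t f g (Defs.glue (Zs n l w) (Ys n w)) *
        marginal_ratio f g u (Ys n w))).
  by apply/funext => w; rewrite /TEV_IS TEV_of_weightsE.
apply: unbiasedB.
  (* By [weightM] the density [g] of a sample cancels the denominator of its weight, leaving the
     integral of [\1_A f]. *)
  apply: unbiased_mean => // n; apply: ge0_unbiased.
  - under eq_fun do rewrite wtE.
    exact: (measurableT_comp mwt).
  - by move=> w; rewrite wtE.
  under eq_integral do rewrite wtE.
  rewrite (ge0_integral_law (m := P) (V := Xs n) (h := EFin \o g)
    (F := fun x => (\1_A x * f x / g x)%:E) _ _ _ _ (Xs_iid.1 n))//.
  - by rewrite -pYs; apply: eq_integral => x _; rewrite -EFinM weightM.
  - exact/measurable_EFinP.
  - exact/measurable_EFinP.
apply: unbiased_mean => // n.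
have NI0 : (NI%:R : R) != 0 by rewrite pnatr_eq0 -lt0n ltnW.
have NI1 : (NI%:R - 1 : R) != 0 by rewrite subr_eq0 -[1]/(1%:R) eqr_nat gtn_eqF.
(* [c] is rewritten as the normalising constant times one copy of [c] for each ordered pair: [NI]
   choices of [k], then [NI.-1] choices of [l != k]. *)
have -> : c = (NI%:R * (NI%:R - 1))^-1 * ((c *+ NI.-1) *+ NI).
  rewrite -[_ *+ NI]mulr_natl -[c *+ _]mulr_natl.
  rewrite -[in NI.-1%:R](subn1 NI) natrB ?(ltnW hNI)//.
  by field; rewrite NI0 NI1.
apply: unbiasedZ.
have -> : (c *+ NI.-1) *+ NI = (c *+ NI.-1) *+ #|predT : pred 'I_NI| by rewrite card_ord.
apply: unbiased_sum => k _.
have -> : NI.-1 = #|[pred l : 'I_NI | l != k]| by rewrite cardC1 card_ord.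
apply: unbiased_sum => l lk.
apply: ge0_unbiased.
- have mW i : measurable_fun setT
      (fun w => weight phi t f g (Defs.glue (Zs n i w) (Ys n w))).
    under eq_fun do rewrite wtE.
    by apply: (measurableT_comp mwt); exact: measurable_glue.
  apply: measurable_funM; first by apply: measurable_funM; exact: mW.
  have mr : measurable_fun setT (marginal_ratio f g u).
    apply: measurable_funM; first exact: measurable_marginalC.
    by apply: (measurableT_comp measurable_inv); exact: measurable_marginalC.
  exact: (measurableT_comp mr).
- move=> w; rewrite !wtE; apply: mulr_ge0; first exact: mulr_ge0.
  by apply: divr_ge0; exact: marginalC_ge0.
- under eq_integral => w _ do rewrite 2!wtE.
  rewrite -cYs -(pair_expectation mf f0 f1 mg g0 g1 mA g_gt0A (Ys_iid.1 n)
    (Zs_iid n) (k := k) (l := l))//.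
  by rewrite eq_sym.
Qed.
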